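(* Let $L=(G,l)$ be a linkage with $M(L)\ne\emptyset$, and suppose there are vertices $u\ne v$ of $G$ with \[(G,u,v)=(P_1,u,v)\|(P_2,u,v)\|\cdots\|(P_n,u,v)\|(K,u,v),\qquad n\ge2,\] where each $P_i$ is a path graph joining $u$ and $v$ whose edges all have positive length, and $K$ is either empty (the factor being absent) or such that $(K,u,v)$ is a TTSPG. Regard each $P_i$ as a path linkage with the restricted lengths and terminal vertices $u,v$. If $\nabla(P_i)\cap[L,u,v]=\emptyset$ for some $i$, then $M(L)$ is disconnected.
   Context: A graph has a finite vertex set and a finite multiset of edges that are unordered pairs of distinct vertices. A linkage is $L=(G,l)$ with $l:E\to\mathbb R_{\ge0}$; $C(L)=\{p:V\to\mathbb R^2:|p(u)-p(v)|=l(\{u,v\})\ \forall\{u,v\}\in E\}$, and $M(L)$ is the quotient of $C(L)$ by the group of orientation preserving isometries of $\mathbb R^2$ (quotient topology). $[L,u,v]=\{|p(u)-p(v)|:p\in M(L)\}$. Parallel composition of TTGs: $(G_1,s_1,t_1)\|(G_2,s_2,t_2)=(G_1\cup_{s_1\sim s_2,t_1\sim t_2}G_2,s_1,t_1)$; series composition $(G_1,s_1,t_1)\circ(G_2,s_2,t_2)=(G_1\cup_{t_2\sim s_1}G_2,s_2,t_1)$; TTSPGs form the smallest class of TTGs containing a single edge and closed under both compositions. For a path linkage $P$ with terminal vertices (endpoints) $s,t$, let $\theta:M(P)\to\mathbb R$, $\theta(p)=|p(s)-p(t)|$, $[P]=\theta(M(P))$, and $\nabla(P)=\{x\in[P]:\theta^{-1}(x)\text{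 is connected}\}$. *)

(* Defs.v *)
From Stdlib Require Import Reals List Arith.
Open Scope R_scope.

Definition point := (R * R)%type.
Definition dist (a b : point) : R :=
  sqrt ((fst a - fst b) ^ 2 + (snd a - snd b) ^ 2).

(** A graph: vertex type, edge type (edges are labelled, so parallel edges =
    multiset of edges), and the (unordered) pair of endpoints of each edge,
    given by an arbitrary orientation. *)
Record graph := mkGraph { V : Type; E : Type; ends : E -> V * V }.

Definition is_finite (T : Type) : Prop := exists l : list T, forall x, In x l.
Definition finite_graph (G : graph) : Prop := is_finite (V G) /\ is_finite (E G).
Definition loopless (G : graph) : Prop := forall e, fst (ends G e) <> snd (ends G e).

Definition config (G : graph) := V G -> point.
Definition Cfg (G : graph) (l : E G -> R) (p : config G) : Prop :=
  forall e, dist (p (fst (ends G e))) (p (snd (ends G e))) = l e.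

(** Orientation-preserving isometries of R^2: x |-> Rot x + t, Rot = [[c,-s],[s,c]],
    c^2 + s^2 = 1. *)
Definition motion (c s : R) (t : point) (a : point) : point :=
  (c * fst a - s * snd a + fst t, s * fst a + c * snd a + snd t).
Definition act (G : graph) (c s : R) (t : point) (p : config G) : config G :=
  fun v => motion c s t (p v).

Definition saturated (G : graph) (X U : config G -> Prop) : Prop :=
  forall p c s t, c ^ 2 + s ^ 2 = 1 -> X p -> U p -> U (act G c s t p).

(** Relatively open in X for the (product = sup-metric, V finite) topology. *)
Definition rel_open (G : graph) (X U : config G -> Prop) : Prop :=
  forall p, X p -> U p -> exists eps, eps > 0 /\
    forall q, X q -> (forall v, dist (p v) (q v) < eps) -> U q.

(** Open sets of the quotient X / SE(2) are exactly the images of saturated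
    relatively open subsets of X.  For a saturated S ⊆ X, [quot_connected G X S]
    says that the image of S in the quotient X/SE(2) is connected in the
    subspace topology (unfolding the definitions). *)
Definition quot_connected (G : graph) (X S : config G -> Prop) : Prop :=
  ~ exists U1 U2 : config G -> Prop,
      rel_open G X U1 /\ rel_open G X U2 /\
      saturated G X U1 /\ saturated G X U2 /\
      (forall p, S p -> U1 p \/ U2 p) /\
      (forall p, S p -> U1 p -> U2 p -> False) /\
      (exists p, S p /\ U1 p) /\ (exists p, S p /\ U2 p).

Definition M_connected (G : graph) (l : E G -> R) : Prop :=
  quot_connected G (Cfg G l) (Cfg G l).

Definition dist_set (G : graph) (l : E G -> R) (u v : V G) (x : R) : Prop :=
  exists p, Cfg G l p /\ dist (p u) (p v) = x.

Definition path_graph (k : nat) : graph :=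
  mkGraph {j : nat | (j <= k)%nat} {j : nat | (j < k)%nat}
    (fun e => (exist (fun j => (j <= k)%nat) (proj1_sig e)
                     (Nat.lt_le_incl _ _ (proj2_sig e)),
               exist (fun j => (j <= k)%nat) (S (proj1_sig e)) (proj2_sig e))).

Definition path_src (k : nat) : V (path_graph k) :=
  exist (fun j => (j <= k)%nat) 0%nat (Nat.le_0_l k).
Definition path_tgt (k : nat) : V (path_graph k) :=
  exist (fun j => (j <= k)%nat) k (Nat.le_refl k).

Definition path_range (k : nat) (ls : E (path_graph k) -> R) (x : R) : Prop :=
  dist_set (path_graph k) ls (path_src k) (path_tgt k) x.

Definition nabla (k : nat) (ls : E (path_graph k) -> R) (x : R) : Prop :=
  path_range k ls x /\
  quot_connected (path_graph k) (Cfg (path_graph k) ls)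
    (fun q => Cfg (path_graph k) ls q /\
              dist (q (path_src k)) (q (path_tgt k)) = x).

Definition is_uv_path (G : graph) (u v : V G) (k : nat)
    (ws : nat -> V G) (es : nat -> E G) : Prop :=
  (1 <= k)%nat /\ ws 0%nat = u /\ ws k = v /\
  (forall i j, (i <= k)%nat -> (j <= k)%nat -> ws i = ws j -> i = j) /\
  (forall i j, (i < k)%nat -> (j < k)%nat -> es i = es j -> i = j) /\
  (forall j, (j < k)%nat ->
     ends G (es j) = (ws j, ws (S j)) \/ ends G (es j) = (ws (S j), ws j)).

Definition inV (G : graph) (S : E G -> Prop) (w : V G) : Prop :=
  exists e, S e /\ (fst (ends G e) = w \/ snd (ends G e) = w).

(** [SP G S s t]: the subgraph of G spanned by the edge set S, with terminals
    s, t, is a two-terminal series-parallel graph (built up to isomorphism from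
    single edges by series and parallel composition). *)
Inductive SP (G : graph) : (E G -> Prop) -> V G -> V G -> Prop :=
| SP_edge : forall (S : E G -> Prop) s t e,
    s <> t ->
    (forall e', S e' <-> e' = e) ->
    (ends G e = (s, t) \/ ends G e = (t, s)) ->
    SP G S s t
| SP_par : forall (S S1 S2 : E G -> Prop) s t,
    (forall e, S e <-> S1 e \/ S2 e) ->
    (forall e, S1 e -> S2 e -> False) ->
    SP G S1 s t -> SP G S2 s t ->
    (forall w, inV G S1 w -> inV G S2 w -> w = s \/ w = t) ->
    SP G S s t
| SP_ser : forall (S S1 S2 : E G -> Prop) s m t,
    (forall e, S e <-> S1 e \/ S2 e) ->
    (forall e, S1 e -> S2 e -> False) ->
    SP G S1 s m -> SP G S2 m t ->
    (forall w, inV G S1 w -> inV G S2 w -> w = m) ->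
    SP G S s t.

Definition par_decomp (G : graph) (u v : V G) (n : nat) (k : nat -> nat)
    (ws : nat -> nat -> V G) (es : nat -> nat -> E G) (K : E G -> Prop) : Prop :=
  (2 <= n)%nat /\
  (forall i, (i < n)%nat -> is_uv_path G u v (k i) (ws i) (es i)) /\
  ((forall e, ~ K e) \/ SP G K u v) /\
  (forall e, K e \/ exists i j, (i < n)%nat /\ (j < k i)%nat /\ es i j = e) /\
  (forall i j, (i < n)%nat -> (j < k i)%nat -> ~ K (es i j)) /\
  (forall i j i' j', (i < n)%nat -> (i' < n)%nat -> (j < k i)%nat -> (j' < k i')%nat ->
     es i j = es i' j' -> i = i') /\
  (forall i i' j j', (i < n)%nat -> (i' < n)%nat -> i <> i' ->
     (j <= k i)%nat -> (j' <= k i')%nat -> ws i j = ws i' j' ->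
     ws i j = u \/ ws i j = v) /\
  (forall i j, (i < n)%nat -> (j <= k i)%nat -> inV G K (ws i j) ->
     ws i j = u \/ ws i j = v) /\
  (forall w, (exists i j, (i < n)%nat /\ (j <= k i)%nat /\ ws i j = w) \/ inV G K w).

Definition path_lengths (G : graph) (l : E G -> R) (k : nat) (es : nat -> E G)
  : E (path_graph k) -> R :=
  fun e => l (es (proj1_sig e)).

(* Main.v *)
Require Import Defs.
From Stdlib Require Import Reals List Arith.
From Stdlib Require Import Lra Lia Permutation Classical ClassicalEpsilon.
From Coquelicot Require Import Coquelicot.
Open Scope R_scope.

(** Closing the path [P_i] by a segment of length [x = |p(u) - p(v)|] gives a
    polygon. If in some configuration of [L] the two longest edges of [P_i] are
    parallel, then no three sides of that polygon are pairwise longer than half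
    of the perimeter, so the space of polygons with these side lengths is
    connected and [x] lies in nabla(P_i). Under the hypothesis this never happens,
    so the sign of the determinant of these two edge vectors is a continuous,
    rotation invariant function on C(L), and both signs occur because C(L) is
    invariant under reflections. *)

(** * Continuity and quasi-components of spaces of configurations *)

(** One of three sides that are pairwise longer than half of the perimeter may be the closing
    segment, whose length [x] varies over C(L). The other two are then edges of P_i, and if the
    segment is not involved all three are; in either case the two longest edges of P_i can be taken
    among the three. This is why one pair of edges, chosen from the lengths alone, serves for every
    configuration at once. The hard direction is the connectedness of the polygon spaces. All
    deformations there come from one device, a triangle with two fixed sides and a varying base on
    the real axis. Two degenerations shape the proof: a base that shrinks to 0, where the direction
    of the base is lost, and a flat triangle, where its orientation can be switched. *)

Definition tends {X} (F : (X -> Prop) -> Prop) (f : X -> R) (p : X) : Prop :=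
  filterlim f F (locally (f p)).

Lemma tends_const {X} (F : (X -> Prop) -> Prop) {FF : Filter F} (c : R) p :
  tends F (fun _ => c) p.
Proof. apply filterlim_const. Qed.

Lemma tends_plus {X} (F : (X -> Prop) -> Prop) {FF : Filter F} f g p :
  tends F f p -> tends F g p -> tends F (fun x => f x + g x) p.
Proof.
  intros Hf Hg.
  apply (filterlim_comp_2 f g Rplus Hf Hg).
  apply (filterlim_plus (f p) (g p)).
Qed.

Lemma tends_mult {X} (F : (X -> Prop) -> Prop) {FF : Filter F} f g p :
  tends F f p -> tends F g p -> tends F (fun x => f x * g x) p.
Proof.
  intros Hf Hg.
  apply (filterlim_comp_2 f g Rmult Hf Hg).
  apply (filterlim_mult (f p) (g p)).
Qed.

Lemma tends_comp {X} (F : (X -> Prop) -> Prop) (g : R -> R) f p :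
  tends F f p -> continuous g (f p) -> tends F (fun x => g (f x)) p.
Proof.
  intros Hf Hg. exact (filterlim_comp _ _ _ f g F _ _ Hf Hg).
Qed.

Lemma tends_opp {X} (F : (X -> Prop) -> Prop) {FF : Filter F} f p :
  tends F f p -> tends F (fun x => - f x) p.
Proof.
  intros Hf. apply (tends_comp F Ropp f p Hf).
  apply (continuous_opp (fun x : R => x)), continuous_id.
Qed.

Lemma tends_minus {X} (F : (X -> Prop) -> Prop) {FF : Filter F} f g p :
  tends F f p -> tends F g p -> tends F (fun x => f x - g x) p.
Proof. intros; apply tends_plus; auto; now apply tends_opp. Qed.

Lemma tends_pow {X} (F : (X -> Prop) -> Prop) {FF : Filter F} f n p :
  tends F f p -> tends F (fun x => f x ^ n) p.
Proof.
  intros Hf. induction n as [|n IH]; simpl.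
  - apply tends_const, FF.
  - now apply tends_mult.
Qed.

Lemma tends_sqrt {X} (F : (X -> Prop) -> Prop) f p :
  tends F f p -> tends F (fun x => sqrt (f x)) p.
Proof. intros Hf. apply (tends_comp F sqrt f p Hf), continuous_sqrt. Qed.

Lemma tends_pos {X} (F : (X -> Prop) -> Prop) f p :
  tends F f p -> 0 < f p -> F (fun x => 0 < f x).
Proof.
  intros Hf H0. apply (Hf (fun y => 0 < y)), open_gt, H0.
Qed.

Definition ctends {X} (F : (X -> Prop) -> Prop) (f : X -> C) (p : X) : Prop :=
  tends F (fun x => fst (f x)) p /\ tends F (fun x => snd (f x)) p.

Ltac tend := repeat first [ assumption | typeclasses eauto | apply tends_const | apply tends_plus
  | apply tends_minus | apply tends_opp | apply tends_mult | apply tends_pow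
  | apply tends_sqrt ].

Lemma ctends_const {X} (F : (X -> Prop) -> Prop) {FF : Filter F} (c : C) p :
  ctends F (fun _ => c) p.
Proof. split; tend. Qed.

Lemma ctends_plus {X} (F : (X -> Prop) -> Prop) {FF : Filter F} f g p :
  ctends F f p -> ctends F g p -> ctends F (fun x => f x + g x)%C p.
Proof. intros [] []; split; simpl; tend. Qed.

Lemma ctends_opp {X} (F : (X -> Prop) -> Prop) {FF : Filter F} f p :
  ctends F f p -> ctends F (fun x => - f x)%C p.
Proof. intros []; split; simpl; tend. Qed.

Lemma ctends_minus {X} (F : (X -> Prop) -> Prop) {FF : Filter F} f g p :
  ctends F f p -> ctends F g p -> ctends F (fun x => f x - g x)%C p.
Proof. intros [] []; split; simpl; tend. Qed.

Lemma ctends_mult {X} (F : (X -> Prop) -> Prop) {FF : Filter F} f g p :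
  ctends F f p -> ctends F g p -> ctends F (fun x => f x * g x)%C p.
Proof. intros [] []; split; simpl; tend. Qed.

Lemma ctends_RtoC {X} (F : (X -> Prop) -> Prop) {FF : Filter F} f p :
  tends F f p -> ctends F (fun x => RtoC (f x)) p.
Proof. intros; split; simpl; tend. Qed.

Lemma ctends_comp {X} (F : (X -> Prop) -> Prop) (g : R -> C) f p :
  tends F f p -> ctends (locally (f p)) g (f p) -> ctends F (fun x => g (f x)) p.
Proof.
  intros Hf [G1 G2]. split.
  - exact (filterlim_comp _ _ _ f (fun t => fst (g t)) F _ _ Hf G1).
  - exact (filterlim_comp _ _ _ f (fun t => snd (g t)) F _ _ Hf G2).
Qed.

Lemma ctends_near {X} (F : (X -> Prop) -> Prop) {FF : Filter F} f p eps :
  ctends F f p -> 0 < eps -> F (fun x => Cmod (f p - f x) < eps).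
Proof.
  intros [H1 H2] He.
  assert (T : tends F (fun x => eps - Cmod (f p - f x)) p)
    by (unfold Cmod; simpl; tend).
  apply tends_pos in T.
  - revert T. apply filter_imp. intros; lra.
  - unfold Cminus. rewrite Cplus_opp_r, Cmod_0. lra.
Qed.

(** A finite list of coordinates allows one neighbourhood for all of them; hence the lists [D]
    throughout. *)
Lemma ctends_near_all {X Y} (F : (X -> Prop) -> Prop) {FF : Filter F}
    (D : list Y) (f : X -> Y -> C) p eps :
  (forall v, In v D -> ctends F (fun x => f x v) p) -> 0 < eps ->
  F (fun x => forall v, In v D -> Cmod (f p v - f x v) < eps).
Proof.
  intros Hf He. induction D as [|v D IH].
  - apply filter_forall. intros y v [].
  - assert (H1 := ctends_near F _ p eps (Hf v (or_introl eq_refl)) He).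
    assert (H2 := IH (fun w Hw => Hf w (or_intror Hw))).
    generalize (filter_and _ _ H1 H2). apply filter_imp.
    intros y [A B] w [<-|Hw]; auto.
Qed.

(** Sides of a polygon are indexed by all of [nat], but only finitely many indices carry data; [D]
    singles them out. *)
Definition cnear {X} (D : X -> Prop) (p : X -> C) (P : (X -> C) -> Prop) : Prop :=
  exists eps, 0 < eps /\
    forall q, (forall v, D v -> Cmod (p v - q v) < eps) -> P q.

#[export] Instance cnear_filter {X} (D : X -> Prop) p : Filter (cnear D p).
Proof.
  split.
  - exists 1; split; [lra | auto].
  - intros P Q [e1 [H1 K1]] [e2 [H2 K2]].
    exists (Rmin e1 e2); split; [now apply Rmin_glb_lt|].
    intros q Hq; split; [apply K1 | apply K2]; intros v Dv;
      eapply Rlt_le_trans; [apply Hq, Dv | apply Rmin_l | apply Hq, Dv | apply Rmin_r].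
  - intros P Q HPQ [e [He K]]. exists e; split; auto.
Qed.

Lemma fst_le_Cmod z : Rabs (fst z) <= Cmod z.
Proof. eapply Rle_trans; [apply Rmax_l | apply Rmax_Cmod]. Qed.

Lemma snd_le_Cmod z : Rabs (snd z) <= Cmod z.
Proof. eapply Rle_trans; [apply Rmax_r | apply Rmax_Cmod]. Qed.

Lemma ctends_coord {X} (D : X -> Prop) p v :
  D v -> ctends (cnear D p) (fun q => q v) p.
Proof.
  intros Dv; split; intros P [e He]; exists e; (split; [apply cond_pos|]);
    intros q Hq; apply He; specialize (Hq v Dv).
  - change (Rabs (fst (q v) - fst (p v)) < e). rewrite Rabs_minus_sym.
    eapply Rle_lt_trans; [apply (fst_le_Cmod (p v - q v)%C) | exact Hq].
  - change (Rabs (snd (q v) - snd (p v)) < e). rewrite Rabs_minus_sym.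
    eapply Rle_lt_trans; [apply (snd_le_Cmod (p v - q v)%C) | exact Hq].
Qed.

Lemma ctends_within {X} (F : (X -> Prop) -> Prop) {FF : Filter F} S f p :
  ctends F f p -> ctends (within S F) f p.
Proof.
  intros [H1 H2]; split; red;
    (eapply filterlim_filter_le_1; [apply filter_le_within | assumption]).
Qed.

(** A relatively clopen subset of [S], given by a single predicate instead of a pair of open
    sets. *)
Definition loc_const {X} (D : X -> Prop) (S P : (X -> C) -> Prop) : Prop :=
  forall p, S p -> cnear D p (fun q => S q -> (P p <-> P q)).

(* Points on the same side of every separation of [S] (its quasi-components).
   Unlike path-connectedness, this needs no concatenation of paths. Only the
   coordinates in [D] count for the topology. *)
Definition conn {X} (D : X -> Prop) (S : (X -> C) -> Prop) (p q : X -> C) : Prop :=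
  forall P, loc_const D S P -> P p -> P q.

Lemma conn_trans {X} (D : X -> Prop) S (p q r : X -> C) :
  conn D S p q -> conn D S q r -> conn D S p r.
Proof. intros H1 H2 P HP Hp. apply H2, H1; auto. Qed.

Lemma conn_sym {X} (D : X -> Prop) S (p q : X -> C) :
  conn D S p q -> conn D S q p.
Proof.
  intros H P HP Hq. apply NNPP; intros Hp.
  apply (H (fun x => ~ P x)); auto.
  intros x Sx. generalize (HP x Sx). apply filter_imp. tauto.
Qed.

(** Such [p] and [q] are at distance 0, so no locally constant predicate separates them; this
    replaces equality of functions. *)
Lemma conn_eq {X} (D : X -> Prop) (S : (X -> C) -> Prop) (p q : X -> C) :
  S p -> S q -> (forall v, D v -> p v = q v) -> conn D S p q.
Proof.
  intros Sp Sq H P HP Pp. destruct (HP p Sp) as [e [He K]].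
  apply K; auto. intros v Dv. rewrite H by auto.
  unfold Cminus. now rewrite Cplus_opp_r, Cmod_0.
Qed.

(** A locally constant predicate on [S'] pulls back along a continuous map to one on [S]. *)
Lemma conn_map {X Y} (D : list X) (D' : list Y) (S : (X -> C) -> Prop)
    (S' : (Y -> C) -> Prop) (F : (X -> C) -> (Y -> C)) p q :
  (forall x, S x -> S' (F x)) ->
  (forall x v, S x -> In v D' ->
     ctends (within S (cnear (fun v => In v D) x)) (fun x => F x v) x) ->
  conn (fun v => In v D) S p q -> conn (fun v => In v D') S' (F p) (F q).
Proof.
  intros HS HF H P HP. apply (H (fun x => P (F x))).
  intros x Sx. destruct (HP (F x) (HS x Sx)) as [e [He K]].
  assert (N : within S (cnear (fun v => In v D) x)
            (fun y => forall v, In v D' -> Cmod (F x v - F y v) < e)).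
  { apply ctends_near_all; auto; typeclasses eauto. }
  revert N. unfold within. apply filter_imp. intros y Hy Sy. apply K; auto.
Qed.

Lemma conn_mono {X} (D D' : list X) (S S' : (X -> C) -> Prop) p q :
  (forall v, In v D' -> In v D) -> (forall x, S x -> S' x) ->
  conn (fun v => In v D) S p q -> conn (fun v => In v D') S' p q.
Proof.
  intros HD H. apply (conn_map D D' S S' (fun x => x)); auto.
  intros x v _ Dv. apply ctends_within; [apply cnear_filter|].
  apply ctends_coord; auto.
Qed.

Definition clamp (a b t : R) := Rmax a (Rmin t b).

Lemma clamp_in a b t : a <= b -> a <= clamp a b t <= b.
Proof. unfold clamp, Rmax, Rmin. repeat destruct Rle_dec; lra. Qed.

Lemma clamp_id a b t : a <= t <= b -> clamp a b t = t.
Proof. unfold clamp, Rmax, Rmin. repeat destruct Rle_dec; lra. Qed.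

Lemma clamp_lip a b t s : Rabs (clamp a b t - clamp a b s) <= Rabs (t - s).
Proof.
  unfold clamp, Rmax, Rmin, Rabs.
  repeat destruct Rle_dec; repeat destruct Rcase_abs; lra.
Qed.

(* Connectedness of [a, b], by the intermediate value theorem for the
   indicator function of a locally constant predicate. *)
Lemma conn_path {X} (D : list X) (S : (X -> C) -> Prop) (g : R -> X -> C) a b :
  a <= b ->
  (forall t, a <= t <= b -> S (g t)) ->
  (forall t v, a <= t <= b -> In v D -> ctends (locally t) (fun t => g t v) t) ->
  conn (fun v => In v D) S (g a) (g b).
Proof.
  intros ab HS Hg P HP Pa. apply NNPP; intros Pb.
  (* The values avoid 0, so a root is absurd. Clamping extends [f] beyond [a, b], because two-sided
     continuity is required at the end points as well. *)
  pose (f := fun t => if excluded_middle_informative (P (g (clamp a b t)))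
                      then -1 else 1).
  assert (fa : f a < 0).
  { unfold f. rewrite clamp_id by lra.
    destruct excluded_middle_informative; [lra | tauto]. }
  assert (fb : 0 < f b).
  { unfold f. rewrite clamp_id by lra.
    destruct excluded_middle_informative; [tauto | lra]. }
  assert (a < b).
  { destruct ab as [|<-]; auto. lra. }
  destruct (Ranalysis5.IVT_interv f a b) as [z [_ Hz]]; auto.
  2: { unfold f in Hz. destruct excluded_middle_informative; lra. }
  intros t Ht. apply continuity_pt_filterlim.
  destruct (HP (g t) (HS t Ht)) as [e [He K]].
  assert (N : locally t (fun s => forall v, In v D -> Cmod (g t v - g s v) < e)).
  { apply ctends_near_all; auto; typeclasses eauto. }
  apply (filterlim_ext_loc (fun _ => f t)); [|apply filterlim_const].
  destruct N as [d Hd]. exists d. intros s Hs.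
  assert (Hs' : ball t d (clamp a b s)).
  { change (Rabs (clamp a b s - t) < d). rewrite <- (clamp_id a b t) by lra.
    eapply Rle_lt_trans; [apply clamp_lip | exact Hs]. }
  specialize (Hd _ Hs').
  specialize (K (g (clamp a b s)) Hd (HS _ (clamp_in a b s ab))).
  unfold f. rewrite (clamp_id a b t) by lra.
  repeat destruct excluded_middle_informative; tauto || reflexivity.
Qed.

(** * Triangles and chains in the complex plane *)

Lemma Cmod_sqr z : Cmod z ^ 2 = fst z ^ 2 + snd z ^ 2.
Proof. unfold Cmod. rewrite pow2_sqrt; auto. nra. Qed.

Lemma Cmod_eq z r : 0 <= r -> fst z ^ 2 + snd z ^ 2 = r ^ 2 -> Cmod z = r.
Proof. intros Hr H. unfold Cmod. rewrite H. now apply sqrt_pow2. Qed.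

Lemma Cmod_RtoC_pos t : 0 <= t -> Cmod (RtoC t) = t.
Proof. intros. rewrite Cmod_R. now apply Rabs_pos_eq. Qed.

Lemma Cmod_minus_sym a b : Cmod (a - b) = Cmod (b - a).
Proof. rewrite <- Cmod_opp. f_equal. ring. Qed.

Lemma Cmod_triangle_rev a b : Rabs (Cmod a - Cmod b) <= Cmod (a + b).
Proof.
  assert (H1 := Cmod_triangle (a + b) (- b)).
  assert (H2 := Cmod_triangle (a + b) (- a)).
  replace (a + b + - b)%C with a in H1 by ring.
  replace (a + b + - a)%C with b in H2 by ring.
  rewrite Cmod_opp in H1, H2. apply Rabs_le. lra.
Qed.

(* The apex of the triangle with base [0, t] and sides [r] (at [0]) and [c]
   (at [t]), above or below the base according to [s = 1] or [s = -1]. For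
   [t = 0] the quotient is meaningful only because [r = c] makes it vanish. *)
Definition tri (r c s t : R) : C :=
  (t / 2 + (r ^ 2 - c ^ 2) / 2 * / t,
   s * sqrt (r ^ 2 - (t / 2 + (r ^ 2 - c ^ 2) / 2 * / t) ^ 2)).

(** By the law of cosines the abscissa [x] satisfies 2 t x = t^2 + r^2 - c^2, and the triangle
    inequalities give |x| <= r, so the radicand is nonnegative. *)
Lemma tri_mod r c s t : 0 <= r -> 0 <= c -> s = 1 \/ s = -1 ->
  Rabs (r - c) <= t <= r + c -> 0 < t \/ r = c ->
  Cmod (tri r c s t) = r /\ Cmod (t - tri r c s t) = c.
Proof.
  intros Hr Hc Hs Ht H0.
  assert (S2 : s ^ 2 = 1) by (destruct Hs; subst; ring).
  assert (Ht' : r - c <= t /\ c - r <= t).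
  { unfold Rabs in Ht. destruct Rcase_abs; lra. }
  unfold tri. set (x := t / 2 + (r ^ 2 - c ^ 2) / 2 * / t).
  assert (Hx : 2 * t * x = t ^ 2 + r ^ 2 - c ^ 2).
  { unfold x. destruct (Req_dec t 0) as [->|]; [|field; auto].
    replace c with r by lra. lra. }
  assert (Hrx : 0 <= r ^ 2 - x ^ 2).
  { destruct (Req_dec t 0) as [Z|Z].
    - replace x with 0; [nra|]. unfold x. replace c with r by lra. rewrite Z. lra.
    - assert (0 < t) by (destruct H0; [|destruct Ht']; lra).
      assert (x <= r) by nra. assert (- r <= x) by nra. nra. }
  assert (Hy := pow2_sqrt _ Hrx). set (y := sqrt (r ^ 2 - x ^ 2)) in *.
  split; apply Cmod_eq; auto; simpl fst; simpl snd.
  - rewrite Rpow_mult_distr, S2, Hy. ring.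
  - transitivity ((t - x) ^ 2 + s ^ 2 * y ^ 2); [ring|].
    rewrite S2, Hy. nra.
Qed.

(** For [r = c] the quotient term is identically 0, so an isosceles triangle stays continuous while
    its base collapses. *)
Lemma tri_ctends r c s t : t <> 0 \/ r = c -> ctends (locally t) (tri r c s) t.
Proof.
  intros H0.
  assert (T : tends (locally t) (fun x => x) t) by (apply filterlim_id).
  assert (T2 : tends (locally t) (fun t => t / 2 + (r ^ 2 - c ^ 2) / 2 * / t) t).
  { apply tends_plus; [tend|tend|].
    destruct H0 as [H0|<-].
    - apply tends_mult; [tend|tend|].
      apply (tends_comp _ Rinv _ _ T). now apply continuous_Rinv.
    - apply (filterlim_ext (fun _ => 0)); [intros; lra|].
      replace ((r ^ 2 - r ^ 2) / 2 * / t) with 0 by lra.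
      apply filterlim_const. }
  assert (T3 := tends_pow _ _ 2 _ T2).
  split; [exact T2|]. unfold tri. cbn beta iota delta [fst snd]. tend.
Qed.

(** The three side lengths determine the apex up to reflection in the base; [s] is the sign of its
    ordinate. *)
Lemma tri_complete z c t : 0 < t -> 0 <= c -> Cmod (t - z) = c ->
  exists s, (s = 1 \/ s = -1) /\ z = tri (Cmod z) c s t.
Proof.
  intros Ht Hc H. assert (H1 := Cmod_sqr z). assert (H2 := Cmod_sqr (t - z)%C).
  rewrite H in H2. simpl fst in H2. simpl snd in H2. unfold tri. rewrite H1, H2. clear H H1 H2.
  destruct z as [x y]; simpl fst in *; simpl snd in *.
  replace (t / 2 + (x ^ 2 + y ^ 2 - ((t + - x) ^ 2 + (0 + - y) ^ 2)) / 2 * / t)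
    with x by (field; lra).
  replace (x ^ 2 + y ^ 2 - x ^ 2) with (Rsqr y) by (unfold Rsqr; ring).
  rewrite sqrt_Rsqr_abs. unfold Rabs. destruct Rcase_abs.
  - exists (-1); split; auto. f_equal. ring.
  - exists 1; split; auto. f_equal. ring.
Qed.

Lemma tri_iso r s : 0 <= r -> tri r r s 0 = (0, s * r).
Proof.
  intros. unfold tri. replace (0 / 2 + (r ^ 2 - r ^ 2) / 2 * / 0) with 0 by lra.
  replace (r ^ 2 - 0 ^ 2) with (r ^ 2) by ring. now rewrite sqrt_pow2.
Qed.

Lemma tri_flat_top r c s : 0 <= r -> 0 <= c -> 0 < r + c -> tri r c s (r + c) = RtoC r.
Proof.
  intros. unfold tri, RtoC.
  replace ((r + c) / 2 + (r ^ 2 - c ^ 2) / 2 * / (r + c)) with r by (field; lra).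
  replace (r ^ 2 - r ^ 2) with 0 by ring. rewrite sqrt_0. f_equal; ring.
Qed.

(** The value does not depend on [s]: here the orientation of the triangle can be switched. *)
Lemma tri_flat_bottom r c s : 0 < r - c -> tri r c s (r - c) = RtoC r.
Proof.
  intros. unfold tri, RtoC.
  replace ((r - c) / 2 + (r ^ 2 - c ^ 2) / 2 * / (r - c)) with r by (field; lra).
  replace (r ^ 2 - r ^ 2) with 0 by ring. rewrite sqrt_0. f_equal; ring.
Qed.

Lemma unit_between z w : Cmod z = Cmod w -> exists m, Cmod m = 1 /\ w = (m * z)%C.
Proof.
  intros H. destruct (Req_dec (Cmod z) 0) as [Z|Z].
  - exists (RtoC 1). split; [rewrite Cmod_R; apply Rabs_R1|].
    rewrite (Cmod_eq_0 z Z). rewrite H in Z. rewrite (Cmod_eq_0 w Z). ring.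
  - assert (z <> RtoC 0) by (intros ->; apply Z, Cmod_0).
    exists (w / z)%C. split; [rewrite Cmod_div, <- H by auto; now field|].
    now field.
Qed.

Lemma tri_normal A B : exists w s, Cmod w = 1 /\ (s = 1 \/ s = -1) /\
  (w * (A + B) = RtoC (Cmod (A + B)))%C /\
  (w * A = tri (Cmod A) (Cmod B) s (Cmod (A + B)))%C.
Proof.
  destruct (Req_dec (Cmod (A + B)) 0) as [Z|Z].
  - assert (HB : B = (- A)%C).
    { replace B with (A + B - A)%C by ring. rewrite (Cmod_eq_0 _ Z). ring. }
    rewrite Z, HB, Cmod_opp, <- HB.
    (* The base is 0 and any rotation keeps it there. The one chosen moves [A] to the positive
       imaginary axis, where [tri_iso] puts the apex for [s = 1]. *)
    destruct (unit_between A (0, Cmod A)) as [m [M1 M2]].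
    { symmetry. apply Cmod_eq; [apply Cmod_ge_0|]. simpl; ring. }
    exists m, 1. rewrite tri_iso, Rmult_1_l by apply Cmod_ge_0. repeat split; auto.
    rewrite (Cmod_eq_0 _ Z). ring.
  - assert (0 < Cmod (A + B)) by (assert (P := Cmod_ge_0 (A + B)); lra).
    destruct (unit_between (A + B)%C (RtoC (Cmod (A + B)))) as [m [M1 M2]].
    { rewrite Cmod_RtoC_pos; lra. }
    destruct (tri_complete (m * A)%C (Cmod B) (Cmod (A + B))) as [s [S1 S2]]; auto.
    { apply Cmod_ge_0. }
    { rewrite M2. replace (m * (A + B) - m * A)%C with (m * B)%C by ring.
      rewrite Cmod_mult, M1. ring. }
    exists m, s. repeat split; auto.
    rewrite Cmod_mult, M1, Rmult_1_l in S2. auto.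
Qed.

(** * Chains of planar vectors with prescribed lengths *)

Definition Csum (I : list nat) (e : nat -> C) : C :=
  fold_right (fun i s => (e i + s)%C) (RtoC 0) I.
Definition Rsum (I : list nat) (a : nat -> R) : R :=
  fold_right (fun i s => a i + s) 0 I.

Lemma Csum_ext I e f : (forall i, In i I -> e i = f i) -> Csum I e = Csum I f.
Proof.
  intros H. induction I as [|i I IH]; simpl; auto.
  rewrite H, IH; auto with datatypes.
Qed.

Lemma Rsum_ext I e f : (forall i, In i I -> e i = f i) -> Rsum I e = Rsum I f.
Proof.
  intros H. induction I as [|i I IH]; simpl; auto.
  rewrite H, IH; auto with datatypes.
Qed.

Lemma Csum_perm I J e : Permutation I J -> Csum I e = Csum J e.
Proof. induction 1; simpl; try congruence. ring. Qed.

Lemma Rsum_perm I J e : Permutation I J -> Rsum I e = Rsum J e.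
Proof. induction 1; simpl; try congruence. ring. Qed.

Lemma Csum_scal I w e : Csum I (fun i => w * e i)%C = (w * Csum I e)%C.
Proof. induction I as [|i I IH]; simpl; [|rewrite IH]; ring. Qed.

Lemma Csum_ctends {X} (F : (X -> Prop) -> Prop) {FF : Filter F} I f p :
  (forall i, In i I -> ctends F (fun x => f x i) p) ->
  ctends F (fun x => Csum I (f x)) p.
Proof.
  intros H. induction I as [|i I IH]; simpl; [now apply ctends_const|].
  apply ctends_plus; auto with datatypes.
Qed.

Definition arms (I : list nat) (a : nat -> R) (e : nat -> C) : Prop :=
  forall i, In i I -> Cmod (e i) = a i.

Lemma Csum_le I a e : arms I a e -> Cmod (Csum I e) <= Rsum I a.
Proof.
  intros H. induction I as [|i I IH]; simpl.
  - rewrite Cmod_0. lra.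
  - eapply Rle_trans; [apply Cmod_triangle|]. rewrite H by auto with datatypes.
    apply Rplus_le_compat_l, IH. intros j Hj; apply H; auto with datatypes.
Qed.

Lemma Rsum_nonneg I a : (forall i, In i I -> 0 <= a i) -> 0 <= Rsum I a.
Proof.
  intros H. induction I as [|i I IH]; simpl; [lra|].
  apply Rplus_le_le_0_compat; auto with datatypes.
Qed.

Lemma Rsum_ge I a j : (forall i, In i I -> 0 <= a i) -> In j I -> a j <= Rsum I a.
Proof.
  intros H. induction I as [|i I IH]; simpl; [easy|].
  assert (0 <= Rsum I a) by (apply Rsum_nonneg; auto with datatypes).
  assert (0 <= a i) by auto with datatypes.
  intros [<-|Hj]; [lra|]. assert (a j <= Rsum I a) by auto with datatypes. lra.
Qed.

Definition upd {X} (f : nat -> X) (i : nat) (x : X) (j : nat) : X :=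
  if Nat.eq_dec j i then x else f j.

Lemma upd_eq {X} (f : nat -> X) i x : upd f i x i = x.
Proof. unfold upd. destruct Nat.eq_dec; tauto. Qed.

Lemma upd_neq {X} (f : nat -> X) i x j : j <> i -> upd f i x j = f j.
Proof. unfold upd. destruct Nat.eq_dec; tauto. Qed.

Lemma upd_in {X} (f : nat -> X) i x I j : ~ In i I -> In j I -> upd f i x j = f j.
Proof. intros H1 H2. apply upd_neq. intros ->; auto. Qed.

Lemma upd_ctends {X} (F : (X -> Prop) -> Prop) (f : X -> nat -> C) i g p j :
  ctends F g p -> (j <> i -> ctends F (fun x => f x j) p) ->
  ctends F (fun x => upd (f x) i (g x) j) p.
Proof. intros. unfold upd. destruct Nat.eq_dec; auto. Qed.

Lemma Csum_upd I e i z : ~ In i I -> Csum I (upd e i z) = Csum I e.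
Proof. intros H. apply Csum_ext. intros j Hj. now apply (upd_in e i z I). Qed.

Lemma Rsum_upd I e i z : ~ In i I -> Rsum I (upd e i z) = Rsum I e.
Proof. intros H. apply Rsum_ext. intros j Hj. now apply (upd_in e i z I). Qed.

Lemma arms_scal I a e w : Cmod w = 1 -> arms I a e -> arms I a (fun i => w * e i)%C.
Proof. intros Hw H i Hi. rewrite Cmod_mult, Hw, H by auto. ring. Qed.

(** The arc of the unit circle between [w] and 1 is parametrised by its real part; [s] selects the
    half circle containing [w]. *)
Lemma conn_rot (D : list nat) (S : (nat -> C) -> Prop) e w :
  Cmod w = 1 -> S e -> (forall m, Cmod m = 1 -> S (fun i => m * e i)%C) ->
  conn (fun v => In v D) S e (fun i => w * e i)%C.
Proof.
  intros Hw Se HS.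
  assert (H2 := Cmod_sqr w). rewrite Hw in H2.
  assert (Hs : exists s, (s = 1 \/ s = -1) /\ snd w = s * sqrt (1 - fst w ^ 2)).
  { replace (1 - fst w ^ 2) with (Rsqr (snd w)) by (unfold Rsqr; nra).
    rewrite sqrt_Rsqr_abs. unfold Rabs. destruct Rcase_abs.
    - exists (-1); split; auto. ring.
    - exists 1; split; auto. ring. }
  destruct Hs as [s [Hs Hsw]].
  pose (m := fun t => (t, s * sqrt (1 - t ^ 2)) : C).
  assert (Hm : forall t, -1 <= t <= 1 -> Cmod (m t) = 1).
  { intros t Ht. assert (Hp : 0 <= 1 - t ^ 2) by nra.
    apply pow2_sqrt in Hp. apply Cmod_eq; [lra|]. unfold m.
    set (y := sqrt (1 - t ^ 2)) in *. simpl fst; simpl snd.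
    destruct Hs; subst s; lra. }
  apply conn_trans with (fun i => m 1 * e i)%C.
  - apply conn_eq; auto; [apply HS, Hm; lra|]. intros v _. unfold m.
    replace (1 - 1 ^ 2) with 0 by ring. rewrite sqrt_0, Rmult_0_r.
    change (1, 0) with (RtoC 1). ring.
  - apply conn_sym. replace w with (m (fst w)).
    2: { unfold m. rewrite <- Hsw. now destruct w. }
    apply (conn_path D S (fun t i => m t * e i)%C).
    + nra.
    + intros t Ht. apply HS, Hm. nra.
    + intros t v _ _. apply ctends_mult; [typeclasses eauto| |
        apply ctends_const; typeclasses eauto].
      assert (T : tends (locally t) (fun x => x) t) by (apply filterlim_id).
      split; unfold m; cbn beta iota delta [fst snd]; tend.
Qed.

(** The bounds on the sum ensure that, all along a deformation, two further arms can close the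
    chain. *)
Definition chain (I : list nat) (a : nat -> R) (lo hi : R) (e : nat -> C) : Prop :=
  arms I a e /\ exists t, lo <= t <= hi /\ Csum I e = RtoC t.

Lemma arms_cons I a i z e : ~ In i I -> Cmod z = a i -> arms I a e ->
  arms (i :: I) a (upd e i z).
Proof.
  intros Hi Hz H j [<-|Hj]; [now rewrite upd_eq|].
  rewrite (upd_in e i z I) by auto. auto.
Qed.

Lemma Csum_cons_upd I i z e : ~ In i I -> Csum (i :: I) (upd e i z) = (z + Csum I e)%C.
Proof. intros. simpl. now rewrite upd_eq, Csum_upd. Qed.

Lemma coord_within (D : list nat) S p v : In v D ->
  ctends (within S (cnear (fun v => In v D) p)) (fun q => q v) p.
Proof.
  intros. apply ctends_within; [typeclasses eauto|]. now apply ctends_coord.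
Qed.

Lemma conn_chain_cons I a i lo hi e e' :
  ~ In i I -> 0 <= a i -> 
  conn (fun v => In v I) (chain I a lo hi) e e' ->
  conn (fun v => In v (i :: I)) (chain (i :: I) a (lo + a i) (hi + a i))
    (upd e i (RtoC (a i))) (upd e' i (RtoC (a i))).
Proof.
  intros Hi Ha. apply (conn_map I (i :: I) _ _ (fun f => upd f i (RtoC (a i)))).
  - intros f [H1 [t [Ht H2]]]. split.
    + apply arms_cons; auto. now apply Cmod_RtoC_pos.
    + exists (t + a i). split; [lra|]. rewrite Csum_cons_upd, H2 by auto.
      rewrite <- RtoC_plus. f_equal. ring.
  - intros f v _ Hv. apply upd_ctends.
    + apply ctends_const; typeclasses eauto.
    + intros Hvi. apply coord_within. destruct Hv; congruence.
Qed.

Lemma chain_mono I a lo hi lo' hi' e : lo' <= lo -> hi <= hi' ->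
  chain I a lo hi e -> chain I a lo' hi' e.
Proof. intros ? ? [H [t [Ht K]]]. split; auto. exists t; split; auto; lra. Qed.

(* Opening the chain: the first arm and the sum of the others span a triangle
   whose base, kept on the real axis, is lengthened until it is flat; after
   that the first arm stays aligned and the remaining arms are opened. *)
Lemma lift I a : NoDup I -> (forall i, In i I -> 0 <= a i) ->
  forall e t0 t1, 0 <= t0 -> arms I a e -> Csum I e = RtoC t0 ->
  t0 <= t1 <= Rsum I a ->
  exists e', arms I a e' /\ Csum I e' = RtoC t1 /\
    conn (fun v => In v I) (chain I a t0 t1) e e'.
Proof.
  induction I as [|i I IH]; intros ND Ha e t0 t1 H0 He Hs Ht.
  { simpl in Ht. assert (t1 = t0) by lra. subst t1. exists e. repeat split; auto.
    apply conn_eq; auto; split; auto; exists t0; split; auto; lra. }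
  inversion ND as [|? ? Hi ND']; subst.
  assert (Hai : 0 <= a i) by auto with datatypes.
  assert (P2 : forall e r, arms (i :: I) a e -> 0 <= r -> Csum I e = RtoC r ->
    e i = RtoC (a i) -> t0 <= r + a i <= t1 -> exists e', arms (i :: I) a e' /\
    Csum (i :: I) e' = RtoC t1 /\
    conn (fun v => In v (i :: I)) (chain (i :: I) a t0 t1) e e').
  { clear e He Hs. intros e r He Hr Hs Hei Hrt.
    destruct (IH ND') with (e := e) (t0 := r) (t1 := t1 - a i)
      as [f [F1 [F2 F3]]]; auto with datatypes.
    { intros j Hj; apply He; auto with datatypes. }
    { simpl in Ht. lra. }
    assert (A' : arms (i :: I) a (upd e i (RtoC (a i)))).
    { apply arms_cons; auto; [now apply Cmod_RtoC_pos|].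
      intros j Hj; apply He; auto with datatypes. }
    exists (upd f i (RtoC (a i))). split; [|split].
    - apply arms_cons; auto. now apply Cmod_RtoC_pos.
    - rewrite Csum_cons_upd, F2, <- RtoC_plus by auto. f_equal. ring.
    - eapply conn_trans; [|eapply conn_mono; [intros v Hv; exact Hv| |apply conn_chain_cons; eauto]].
      + apply conn_eq.
        * split; auto. exists (r + a i). split; [lra|]. simpl.
          rewrite Hs, Hei, <- RtoC_plus. f_equal; ring.
        * split; auto. exists (r + a i). split; [lra|].
          rewrite Csum_cons_upd, Hs, <- RtoC_plus by auto. f_equal; ring.
        * intros v _. unfold upd. destruct Nat.eq_dec; congruence.
      + intros g. apply chain_mono; lra. }
  assert (Hei := He i (or_introl eq_refl)). simpl in Hs.
  pose (A := Csum I e). fold A in Hs.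
  (* A tail with sum 0 has no direction to turn, but then the first arm alone equals [t0] and is
     already aligned. *)
  destruct (Req_dec (Cmod A) 0) as [Z|Z].
  { assert (A0 := Cmod_eq_0 _ Z). rewrite A0, Cplus_0_r in Hs.
    assert (t0 = a i).
    { rewrite Hs, Cmod_RtoC_pos in Hei; auto. }
    subst t0. apply (P2 e 0); auto; lra. }
  assert (Ar : 0 < Cmod A) by (assert (P := Cmod_ge_0 A); lra).
  set (r := Cmod A) in *.
  destruct (tri_normal A (e i)) as [w [s [Hw [Hs' [W1 W2]]]]].
  assert (Hs2 : (A + e i)%C = RtoC t0) by (rewrite <- Hs; ring). rewrite Hs2 in W1, W2.
  rewrite Cmod_RtoC_pos in W1, W2 by auto. rewrite Hei in W2. fold r in W2.
  assert (TI : Rabs (r - a i) <= t0).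
  { unfold r. rewrite <- Hei. rewrite <- (Cmod_RtoC_pos t0), <- Hs by auto.
    rewrite (Cplus_comm (e i)). apply Cmod_triangle_rev. }
  assert (TI2 : t0 <= r + a i).
  { unfold r. rewrite <- Hei, <- (Cmod_RtoC_pos t0), <- Hs, Rplus_comm by auto.
    apply Cmod_triangle. }
  assert (T0 : forall t, t0 <= t -> 0 < t \/ r = a i).
  { intros t Htt. destruct H0 as [H0|<-]; [left; lra|]. right.
    unfold Rabs in TI. destruct Rcase_abs; lra. }
  (* The tail turns rigidly by a factor which has modulus 1 while the triangle exists, so that its
     sum becomes the apex; arm [i] leads from the apex to [t]. *)
  pose (g := fun t => upd (fun j => e j * (tri r (a i) s t / A))%C i
                        (t - tri r (a i) s t)%C).
  assert (AN : A <> RtoC 0) by (intros E0; apply Z; unfold r; rewrite E0; apply Cmod_0).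
  assert (SI : forall t, Csum I (g t) = tri r (a i) s t).
  { intros t. unfold g. rewrite Csum_upd by auto.
    rewrite (Csum_ext I _ (fun j => tri r (a i) s t / A * e j)%C)
      by (intros; ring).
    rewrite Csum_scal. fold A. now field. }
  assert (Gi : forall t, g t i = (t - tri r (a i) s t)%C).
  { intros; unfold g; apply upd_eq. }
  assert (GS : forall t, Csum (i :: I) (g t) = RtoC t).
  { intros t. simpl. rewrite SI, Gi. ring. }
  assert (Gr : forall t, t0 <= t <= r + a i -> arms (i :: I) a (g t)).
  { intros t Htt. destruct (tri_mod r (a i) s t) as [M1 M2]; auto; [lra|lra|apply T0; lra|].
    unfold g. apply arms_cons; auto. intros j Hj.
    rewrite Cmod_mult, Cmod_div, M1 by auto. fold r. rewrite He by auto with datatypes.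
    field. lra. }
  assert (C1 : forall t, t0 <= t <= t1 -> t <= r + a i ->
    conn (fun v => In v (i :: I)) (chain (i :: I) a t0 t1) e (g t)).
  { intros t Htt Htr. apply conn_trans with (fun j => w * e j)%C.
    (* A chain with sum 0 may be rotated freely without leaving the space; a chain with positive sum
       is already normalised, so [w = 1]. *)
    - destruct (Req_dec t0 0) as [Z0|Z0].
      + apply conn_rot; auto.
        * split; auto. exists t0; split; auto; lra.
        * intros m Hm. split; [now apply arms_scal|]. exists 0. split; [lra|].
          rewrite Csum_scal. simpl. fold A. rewrite Hs, Z0. ring.
      + assert (w = RtoC 1).
        { transitivity (w * RtoC t0 / RtoC t0)%C.
          - field. intros E0. apply Z0. now apply RtoC_inj.
          - rewrite W1. field. intros E0. apply Z0. now apply RtoC_inj. }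
        assert (chain (i :: I) a t0 t1 e) by (split; auto; exists t0; split; auto; lra).
        apply conn_eq; auto.
        * split; [now apply arms_scal|]. exists t0; split; [lra|].
          rewrite Csum_scal. simpl. fold A. now rewrite Hs.
        * intros. subst w. ring.
    - apply conn_trans with (g t0).
      + apply conn_eq.
        * split; [now apply arms_scal|]. exists t0; split; [lra|].
          rewrite Csum_scal. simpl. fold A. now rewrite Hs.
        * split; [apply Gr; lra|]. exists t0; split; [lra|]. apply GS.
        * intros v _. unfold g, upd. destruct Nat.eq_dec as [->|].
          -- rewrite <- W2, <- W1, <- Hs. ring.
          -- rewrite <- W2. now field.
      + apply conn_path; [lra| |].
        * intros x Hx. split; [apply Gr; lra|]. exists x; split; [lra|]. apply GS.
        * intros x v Hx _.
          assert (T := tri_ctends r (a i) s x).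
          assert (H : x <> 0 \/ r = a i).
          { destruct (T0 x); [lra|left; lra|now right]. }
          specialize (T H).
          apply (upd_ctends _ (fun t j => e j * (tri r (a i) s t / A))%C i
                    (fun t => t - tri r (a i) s t)%C).
          -- apply ctends_minus; [typeclasses eauto| |exact T].
             apply (ctends_RtoC (locally x) (fun x => x)), filterlim_id.
          -- intros _. apply ctends_mult; [typeclasses eauto|
               apply ctends_const; typeclasses eauto|].
             unfold Cdiv. apply ctends_mult; [typeclasses eauto|exact T|
               apply ctends_const; typeclasses eauto]. }
  destruct (Rle_dec t1 (r + a i)) as [L|L].
  - exists (g t1). split; [|split]; auto.
    + apply Gr. lra.
    + apply C1; lra.
  - destruct (P2 (g (r + a i)) r) as [f [F1 [F2 F3]]]; auto; try lra.
    + apply Gr; lra.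
    + rewrite SI. apply tri_flat_top; lra.
    + rewrite Gi, tri_flat_top, RtoC_plus by lra. ring.
    + exists f. repeat split; auto. eapply conn_trans; [|exact F3]. apply C1; lra.
Qed.

(** The condition on each [j] is the polygon inequality: no arm is longer than the other arms and
    [t] together. *)
Lemma exists_chain I a : NoDup I -> (forall i, In i I -> 0 <= a i) ->
  forall t, 0 <= t <= Rsum I a -> (forall j, In j I -> 2 * a j - Rsum I a <= t) ->
  exists e, arms I a e /\ Csum I e = RtoC t.
Proof.
  induction I as [|i I IH]; intros ND Ha t Ht Hj.
  { simpl in Ht. exists (fun _ => RtoC 0). split; [easy|]. simpl. f_equal. lra. }
  inversion ND as [|? ? Hi ND']; subst. simpl in Ht.
  assert (Hai : 0 <= a i) by auto with datatypes.
  assert (Ha' : forall j, In j I -> 0 <= a j) by auto with datatypes.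
  assert (Hr := Rsum_nonneg I a Ha').
  assert (Hji := Hj i (or_introl eq_refl)). simpl in Hji.
  (* The largest tail sum allowed both by the triangle with sides [t] and [a i] and by the tail
     itself; a large [r] makes the condition on the tail arms weakest. *)
  set (r := Rmin (t + a i) (Rsum I a)).
  assert (Rr : r <= t + a i /\ r <= Rsum I a) by (split; [apply Rmin_l|apply Rmin_r]).
  assert (Rd : r = t + a i \/ r = Rsum I a) by (unfold r, Rmin; destruct Rle_dec; auto).
  assert (r0 : 0 <= r) by lra.
  destruct (IH ND' Ha' r) as [e [E1 E2]]; [lra| |].
  { intros j Hj'. assert (P1 := Rsum_ge I a j Ha' Hj').
    assert (P2 := Hj j (or_intror Hj')). simpl in P2. lra. }
  destruct (tri_mod r (a i) 1 t) as [M1 M2]; auto.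
  { unfold Rabs; destruct Rcase_abs; lra. }
  { destruct (proj1 Ht); [now left|right]. lra. }
  destruct (unit_between (RtoC r) (tri r (a i) 1 t)) as [m [N1 N2]].
  { rewrite M1. now apply Cmod_RtoC_pos. }
  exists (upd (fun j => m * e j)%C i (t - tri r (a i) 1 t)%C). split.
  - apply arms_cons; auto. now apply arms_scal.
  - rewrite Csum_cons_upd, Csum_scal, E2, <- N2 by auto. ring.
Qed.

(** * Connectedness of polygon spaces *)

Definition poly (I : list nat) (a : nat -> R) (e : nat -> C) : Prop :=
  arms I a e /\ Csum I e = RtoC 0.

Lemma poly_scal I a w e : Cmod w = 1 -> poly I a e -> poly I a (fun i => w * e i)%C.
Proof.
  intros Hw [H1 H2]. split; [now apply arms_scal|]. rewrite Csum_scal, H2. ring.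
Qed.

Lemma poly_rot I a w e : Cmod w = 1 -> poly I a e ->
  conn (fun v => In v I) (poly I a) e (fun i => w * e i)%C.
Proof. intros Hw He. apply conn_rot; auto. intros; now apply poly_scal. Qed.

(* Closes a chain [I], whose sum is on the real axis, by two arms. *)
Definition join (i1 i2 : nat) (I : list nat) (a : nat -> R) (s : R) (e : nat -> C)
  : nat -> C :=
  upd (upd e i1 (- tri (a i1) (a i2) s (fst (Csum I e)))%C) i2
    (tri (a i1) (a i2) s (fst (Csum I e)) - fst (Csum I e))%C.

Lemma join_arm1 i1 i2 I a s e : i1 <> i2 ->
  join i1 i2 I a s e i1 = (- tri (a i1) (a i2) s (fst (Csum I e)))%C.
Proof. intros. unfold join. now rewrite upd_neq, upd_eq. Qed.

Lemma join_arm2 i1 i2 I a s e :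
  join i1 i2 I a s e i2 =
    (tri (a i1) (a i2) s (fst (Csum I e)) - fst (Csum I e))%C.
Proof. intros. unfold join. now rewrite upd_eq. Qed.

Lemma join_rest i1 i2 I a s e j : j <> i1 -> j <> i2 -> join i1 i2 I a s e j = e j.
Proof. intros. unfold join. now rewrite !upd_neq. Qed.

Lemma NoDup_cons2 (i1 i2 : nat) I : NoDup (i1 :: i2 :: I) ->
  i1 <> i2 /\ ~ In i1 I /\ ~ In i2 I /\ NoDup I.
Proof.
  intros H. inversion H as [|? ? H1 H2]; inversion H2; subst. simpl in H1.
  repeat split; auto.
Qed.

Lemma join_poly i1 i2 I a s e t : NoDup (i1 :: i2 :: I) ->
  (forall i, In i (i1 :: i2 :: I) -> 0 <= a i) -> s = 1 \/ s = -1 ->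
  a i2 <= a i1 -> a i1 - a i2 <= t <= a i1 + a i2 ->
  arms I a e -> Csum I e = RtoC t -> poly (i1 :: i2 :: I) a (join i1 i2 I a s e).
Proof.
  intros ND Ha Hs H12 Ht He Hsum. destruct (NoDup_cons2 _ _ _ ND) as [N1 [N2 [N3 N4]]].
  destruct (tri_mod (a i1) (a i2) s t) as [M1 M2]; auto with datatypes.
  { rewrite Rabs_pos_eq; lra. }
  { destruct (Req_dec t 0); [right|left]; lra. }
  split.
  - intros j [<-|[<-|Hj]].
    + now rewrite join_arm1, Hsum, Cmod_opp.
    + now rewrite join_arm2, Hsum, Cmod_minus_sym.
    + rewrite join_rest by (intros ->; auto). auto.
  - simpl. rewrite join_arm1, join_arm2, (Csum_ext I (join i1 i2 I a s e) e), Hsum by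
      (auto; intros; apply join_rest; intros ->; auto).
    simpl fst. ring.
Qed.

(** The bounds [lo] and [hi] keep the closing triangle alive. Its base can reach 0 only if the two
    arms are equal, and there [tri] is still continuous. *)
Lemma join_conn i1 i2 I a s lo hi e e' : NoDup (i1 :: i2 :: I) ->
  (forall i, In i (i1 :: i2 :: I) -> 0 <= a i) -> s = 1 \/ s = -1 ->
  a i2 <= a i1 -> a i1 - a i2 <= lo -> hi <= a i1 + a i2 ->
  conn (fun v => In v I) (chain I a lo hi) e e' ->
  conn (fun v => In v (i1 :: i2 :: I)) (poly (i1 :: i2 :: I) a)
    (join i1 i2 I a s e) (join i1 i2 I a s e').
Proof.
  intros ND Ha Hs H12 Hlo Hhi. apply conn_map.
  - intros f [F1 [t [F2 F3]]]. eapply join_poly; eauto; lra.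
  - intros f v [F1 [t [F2 F3]]] Hv.
    assert (T1 : ctends (within (chain I a lo hi) (cnear (fun v => In v I) f))
                   (Csum I) f).
    { apply (Csum_ctends _ I (fun x => x)).
      intros i Hi. now apply coord_within. }
    assert (T2 := ctends_comp _ (tri (a i1) (a i2) s) _ _ (proj1 T1)).
    cbv beta in T2. rewrite F3 in T2. simpl fst in T2.
    specialize (T2 (tri_ctends (a i1) (a i2) s t
      ltac:(destruct (Req_dec t 0); [right|left]; lra))).
    unfold join.
    apply (upd_ctends _ (fun f => upd f i1 _) i2
             (fun f => tri (a i1) (a i2) s (fst (Csum I f)) - fst (Csum I f))%C).
    + apply ctends_minus; auto; [typeclasses eauto|].
      apply (ctends_RtoC _ (fun f => fst (Csum I f))), T1.
    + intros V2. apply (upd_ctends _ (fun f => f) i1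
             (fun f => - tri (a i1) (a i2) s (fst (Csum I f)))%C).
      * apply ctends_opp; auto; typeclasses eauto.
      * intros V1. apply coord_within. destruct Hv as [|[|]]; congruence.
Qed.

(** Any polygon, once rotated so that the sum over [I] is real, has the form [join]; [lift] then
    stretches this sum to its maximum without changing the orientation [s]. *)
Lemma join_top i1 i2 I a p : NoDup (i1 :: i2 :: I) ->
  (forall i, In i (i1 :: i2 :: I) -> 0 <= a i) -> a i2 <= a i1 ->
  poly (i1 :: i2 :: I) a p ->
  exists s c, (s = 1 \/ s = -1) /\ arms I a c /\
    Csum I c = RtoC (Rmin (a i1 + a i2) (Rsum I a)) /\
    conn (fun v => In v (i1 :: i2 :: I)) (poly (i1 :: i2 :: I) a) p
      (join i1 i2 I a s c).
Proof.
  intros ND Ha H12 Hp. destruct (NoDup_cons2 _ _ _ ND) as [N1 [N2 [N3 N4]]].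
  destruct Hp as [P1 P2]. simpl in P2.
  assert (HD : (- p i1 + - p i2)%C = Csum I p).
  { transitivity (- p i1 + - p i2 + (p i1 + (p i2 + Csum I p)))%C; [|ring].
    rewrite P2. ring. }
  assert (PI : arms I a p) by (intros j Hj; apply P1; auto with datatypes).
  assert (A1 : Cmod (- p i1) = a i1) by (rewrite Cmod_opp; apply P1; auto with datatypes).
  assert (A2 : Cmod (- p i2) = a i2) by (rewrite Cmod_opp; apply P1; auto with datatypes).
  assert (TI := Cmod_triangle_rev (- p i1) (- p i2)).
  assert (TI2 := Cmod_triangle (- p i1) (- p i2)).
  assert (TI3 := Csum_le I a p PI).
  destruct (tri_normal (- p i1) (- p i2)) as [w [s [Hw [Hs [W1 W2]]]]].
  rewrite A1, A2, HD in *. rewrite Rabs_pos_eq in TI by lra.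
  set (t0 := Cmod (Csum I p)) in *. set (t1 := Rmin (a i1 + a i2) (Rsum I a)).
  assert (t1 <= a i1 + a i2 /\ t1 <= Rsum I a) by (split; [apply Rmin_l|apply Rmin_r]).
  assert (t0 <= t1) by now apply Rmin_glb.
  destruct (lift I a N4) with (e := fun i => (w * p i)%C) (t0 := t0) (t1 := t1)
    as [c [C1 [C2 C3]]]; auto with datatypes.
  { apply Cmod_ge_0. }
  { now apply arms_scal. }
  { now rewrite Csum_scal. }
  { lra. }
  exists s, c. do 3 (split; [assumption|]).
  assert (Pp : poly (i1 :: i2 :: I) a p) by (split; auto).
  eapply conn_trans; [apply (poly_rot _ _ w); auto|].
  eapply conn_trans; [|eapply join_conn; [..|exact C3]; auto; lra].
  assert (E : Csum I (fun i => w * p i)%C = RtoC t0) by now rewrite Csum_scal.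
  apply conn_eq.
  - now apply poly_scal.
  - apply (join_poly i1 i2 I a s _ t0); auto. now apply arms_scal.
  - intros v [<-|[<-|Hv]].
    + rewrite join_arm1, E by auto. simpl fst. rewrite <- W2. ring.
    + rewrite join_arm2, E. simpl fst. rewrite <- W2, <- W1, <- HD. ring.
    + rewrite join_rest; auto; intros ->; auto.
Qed.

(** The last two hypotheses say that the sum over [I] can be brought down to [a i1 - a i2]. There
    the two arms are antiparallel and both orientations give the same polygon. *)
Lemma join_flip i1 i2 I a : NoDup (i1 :: i2 :: I) ->
  (forall i, In i (i1 :: i2 :: I) -> 0 <= a i) -> a i2 <= a i1 ->
  a i1 - a i2 <= Rsum I a ->
  (forall j, In j I -> 2 * a j - Rsum I a <= a i1 - a i2) ->
  exists c c', arms I a c /\ arms I a c' /\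
    Csum I c = RtoC (Rmin (a i1 + a i2) (Rsum I a)) /\
    Csum I c' = RtoC (Rmin (a i1 + a i2) (Rsum I a)) /\
    conn (fun v => In v (i1 :: i2 :: I)) (poly (i1 :: i2 :: I) a)
      (join i1 i2 I a 1 c) (join i1 i2 I a (-1) c').
Proof.
  intros ND Ha H12 HS Hj. destruct (NoDup_cons2 _ _ _ ND) as [N1 [N2 [N3 N4]]].
  assert (Ha' : forall i, In i I -> 0 <= a i) by auto with datatypes.
  assert (a2 : 0 <= a i2) by auto with datatypes.
  set (t1 := Rmin (a i1 + a i2) (Rsum I a)).
  assert (T1 : t1 <= a i1 + a i2 /\ t1 <= Rsum I a) by (split; [apply Rmin_l|apply Rmin_r]).
  assert (T2 : a i1 - a i2 <= t1) by (apply Rmin_glb; lra).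
  destruct (exists_chain I a N4 Ha' (a i1 - a i2)) as [e [E1 E2]]; auto; [lra|].
  destruct (lift I a N4 Ha' e (a i1 - a i2) t1) as [c [C1 [C2 C3]]]; auto; [lra..|].
  assert (J : forall s, s = 1 \/ s = -1 -> poly (i1 :: i2 :: I) a (join i1 i2 I a s e)).
  { intros s Hs. eapply join_poly; eauto. lra. }
  destruct (Req_dec (a i1 - a i2) 0) as [Z|Z].
  (* For equal arms the base collapses and the two apexes are opposite points of the imaginary axis.
     A half turn exchanges them, so the second chain starts from the negative of [e]. *)
  - assert (Cmod (RtoC (-1)) = 1) by (rewrite Cmod_R, Rabs_left; lra).
    rewrite Z in E2.
    assert (E2' : Csum I (fun i => RtoC (-1) * e i)%C = RtoC 0)
      by (rewrite Csum_scal, E2; ring).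
    destruct (lift I a N4 Ha' (fun i => RtoC (-1) * e i)%C (a i1 - a i2) t1)
      as [c' [C1' [C2' C3']]]; auto; try lra.
    { now apply arms_scal. }
    { now rewrite Z. }
    exists c, c'. do 4 (split; [assumption|]).
    eapply conn_trans; [|eapply join_conn; [..|exact C3']; auto; lra].
    eapply conn_trans; [eapply conn_sym, join_conn; [..|exact C3]; auto; lra|].
    eapply conn_trans; [apply (poly_rot _ _ (RtoC (-1))); auto|].
    apply conn_eq.
    + apply poly_scal; auto.
    + eapply join_poly; [..|exact E2']; auto; [lra|]. now apply arms_scal.
    + intros v [<-|[<-|Hv]].
      * rewrite !join_arm1, E2, E2' by auto. simpl fst. replace (a i1) with (a i2) by lra.
        rewrite !tri_iso by auto. apply injective_projections; simpl; ring.
      * rewrite !join_arm2, E2, E2' by auto. simpl fst. replace (a i1) with (a i2) by lra.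
        rewrite !tri_iso by auto. apply injective_projections; simpl; ring.
      * rewrite !join_rest; auto; intros ->; auto.
  - exists c, c. do 4 (split; [assumption|]).
    eapply conn_trans; [|eapply join_conn; [..|exact C3]; auto; lra].
    eapply conn_trans; [eapply conn_sym, join_conn; [..|exact C3]; auto; lra|].
    apply conn_eq; auto.
    intros v [<-|[<-|Hv]].
    + rewrite !join_arm1, E2 by auto. simpl fst. rewrite !tri_flat_bottom by lra. auto.
    + rewrite !join_arm2, E2 by auto. simpl fst. rewrite !tri_flat_bottom by lra. auto.
    + rewrite !join_rest; auto; intros ->; auto.
Qed.

(* Two arms over a fixed base behave as one rigid arm [i1] of length [t]. *)
Lemma join_base i1 i2 I a s t c c' : NoDup (i1 :: i2 :: I) ->
  (forall i, In i (i1 :: i2 :: I) -> 0 <= a i) -> s = 1 \/ s = -1 ->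
  a i2 <= a i1 -> a i1 - a i2 <= t <= a i1 + a i2 -> 0 < t ->
  arms I a c -> Csum I c = RtoC t -> arms I a c' -> Csum I c' = RtoC t ->
  (forall f f', poly (i1 :: I) (upd a i1 t) f -> poly (i1 :: I) (upd a i1 t) f' ->
     conn (fun v => In v (i1 :: I)) (poly (i1 :: I) (upd a i1 t)) f f') ->
  conn (fun v => In v (i1 :: i2 :: I)) (poly (i1 :: i2 :: I) a)
    (join i1 i2 I a s c) (join i1 i2 I a s c').
Proof.
  intros ND Ha Hs H12 Ht Ht0 Hc Sc Hc' Sc' IH.
  destruct (NoDup_cons2 _ _ _ ND) as [N1 [N2 [N3 N4]]].
  destruct (tri_mod (a i1) (a i2) s t) as [M1 M2]; auto with datatypes.
  { rewrite Rabs_pos_eq; lra. }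
  set (z := tri (a i1) (a i2) s t) in *.
  assert (TN : RtoC t <> RtoC 0) by (intros E; apply RtoC_inj in E; lra).
  (* The rigid arm is split into the other two sides of a triangle attached to it; [z / t] and
     [1 - z / t] are their complex ratios to the arm. *)
  pose (G := fun f : nat -> C => upd (upd f i1 (z / t * f i1)%C) i2 ((1 - z / t) * f i1)%C).
  assert (HG : forall f, poly (i1 :: I) (upd a i1 t) f -> poly (i1 :: i2 :: I) a (G f)).
  { intros f [F1 F2]. assert (F3 := F1 i1 (or_introl eq_refl)). rewrite upd_eq in F3.
    split.
    - intros j Hj. unfold G, upd at 1. destruct Nat.eq_dec as [->|Nj].
      + rewrite Cmod_mult, F3. replace (1 - z / t)%C with ((t - z) / t)%C by now field.
        rewrite Cmod_div, M2, Cmod_RtoC_pos by (auto; lra). field. lra.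
      + unfold upd. destruct Nat.eq_dec as [->|Nj'].
        * rewrite Cmod_mult, F3, Cmod_div, M1, Cmod_RtoC_pos by (auto; lra).
          field. lra.
        * destruct Hj as [|[|Hj]]; try congruence.
          rewrite F1 by auto with datatypes. now rewrite upd_neq.
    - rewrite <- F2. simpl. unfold G. rewrite upd_eq, upd_neq, upd_eq by auto.
      rewrite !Csum_upd by auto. ring. }
  assert (Hf : forall c, arms I a c -> Csum I c = RtoC t ->
     poly (i1 :: I) (upd a i1 t) (upd c i1 (- t)%C)).
  { intros d D1 D2. split.
    - apply arms_cons; auto.
      + rewrite upd_eq, Cmod_opp, Cmod_RtoC_pos; lra.
      + intros j Hj. rewrite (upd_in a i1 t I) by auto. auto.
    - rewrite Csum_cons_upd, D2 by auto. ring. }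
  assert (HE : forall c, arms I a c -> Csum I c = RtoC t ->
    conn (fun v => In v (i1 :: i2 :: I)) (poly (i1 :: i2 :: I) a)
    (join i1 i2 I a s c) (G (upd c i1 (- t)%C))).
  { intros d D1 D2. apply conn_eq.
    - eapply join_poly; eauto.
    - apply HG, Hf; auto.
    - intros v [<-|[<-|Hv]].
      + rewrite join_arm1, D2 by auto. simpl fst. fold z. unfold G.
        rewrite upd_neq, !upd_eq by auto. now field.
      + rewrite join_arm2, D2 by auto. simpl fst. fold z. unfold G.
        rewrite !upd_eq by auto. now field.
      + unfold G. rewrite join_rest by (intros ->; auto).
        rewrite !upd_neq by (intros ->; auto). auto. }
  eapply conn_trans; [apply HE; auto|].
  eapply conn_trans; [|apply conn_sym, HE; auto].
  eapply (conn_map (i1 :: I)); [exact HG| |apply IH; apply Hf; auto].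
  intros f v _ Hv. unfold G.
  apply (upd_ctends _ (fun f => upd f i1 _) i2 (fun f => (1 - z / t) * f i1)%C).
  - apply ctends_mult; [typeclasses eauto|apply ctends_const; typeclasses eauto|].
    apply coord_within. auto with datatypes.
  - intros V2. apply (upd_ctends _ (fun f => f) i1 (fun f => z / t * f i1)%C).
    + apply ctends_mult; [typeclasses eauto|apply ctends_const; typeclasses eauto|].
      apply coord_within. auto with datatypes.
    + intros V1. apply coord_within. destruct Hv as [|[|]]; try congruence. now right.
Qed.

(** The polygon is a segment run through back and forth, so all such polygons form one orbit under
    rotation. *)
Lemma poly_conn_flat i1 i2 I a p q : NoDup (i1 :: i2 :: I) ->
  (forall j, In j I -> a j = 0) ->
  poly (i1 :: i2 :: I) a p -> poly (i1 :: i2 :: I) a q ->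
  conn (fun v => In v (i1 :: i2 :: I)) (poly (i1 :: i2 :: I) a) p q.
Proof.
  intros ND Ha Hp Hq.
  assert (Z : forall p, poly (i1 :: i2 :: I) a p ->
    (forall j, In j I -> p j = RtoC 0) /\ p i2 = (- p i1)%C).
  { clear p q Hp Hq. intros p [P1 P2].
    assert (H : forall j, In j I -> p j = RtoC 0).
    { intros j Hj. apply Cmod_eq_0. rewrite P1, Ha; auto with datatypes. }
    split; auto. simpl in P2.
    rewrite (Csum_ext I p (fun i => RtoC 0 * p i)%C), Csum_scal in P2.
    - replace (p i2) with (p i1 + (p i2 + RtoC 0 * Csum I p) - p i1)%C by ring.
      rewrite P2. ring.
    - intros j Hj. rewrite H by auto. ring. }
  destruct (Z p Hp) as [P1 P2]. destruct (Z q Hq) as [Q1 Q2].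
  destruct (unit_between (p i1) (q i1)) as [m [M1 M2]].
  { rewrite (proj1 Hp), (proj1 Hq); auto with datatypes. }
  eapply conn_trans; [apply (poly_rot _ _ m); auto|].
  apply conn_eq; auto; [now apply poly_scal|].
  intros v [<-|[<-|Hv]].
  - now rewrite M2.
  - rewrite P2, Q2, M2. ring.
  - rewrite P1, Q1 by auto. ring.
Qed.

Lemma select_max (I : list nat) (a : nat -> R) : I <> nil ->
  exists i I', Permutation I (i :: I') /\ forall j, In j I' -> a j <= a i.
Proof.
  induction I as [|i I IH]; intros H; [easy|].
  destruct I as [|i' I].
  - exists i, nil. split; auto. easy.
  - destruct IH as [k [I' [P HI]]]; [easy|].
    destruct (Rle_dec (a i) (a k)).
    + exists k, (i :: I'). split.
      * rewrite P. apply perm_swap.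
      * intros j [<-|Hj]; auto.
    + exists i, (k :: I'). split; [now rewrite P|].
      intros j [<-|Hj]; [lra|]. specialize (HI j Hj). lra.
Qed.

Lemma select_two (I : list nat) (a : nat -> R) : (2 <= length I)%nat ->
  exists i1 i2 I', Permutation I (i1 :: i2 :: I') /\ a i2 <= a i1 /\
    forall j, In j I' -> a j <= a i2.
Proof.
  intros H. destruct (select_max I a) as [i1 [I1 [P1 M1]]].
  { intros ->. simpl in H. lia. }
  destruct (select_max I1 a) as [i2 [I2 [P2 M2]]].
  { intros ->. apply Permutation_length in P1. simpl in P1. lia. }
  exists i1, i2, I2. split; [|split]; auto.
  - rewrite P1. now constructor.
  - apply M1. eapply Permutation_in; [symmetry; exact P2|now left].
Qed.

Lemma poly_perm I J a e : Permutation I J -> poly I a e -> poly J a e.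
Proof.
  intros P [H1 H2]. split.
  - intros j Hj. apply H1. eapply Permutation_in; [symmetry; exact P|auto].
  - now rewrite <- (Csum_perm I J).
Qed.

(* The moduli space of planar polygons is connected unless three sides are
   pairwise longer than half of the perimeter; [i0] is the side that may be long.
   The sum of all but the two longest sides is made as long as possible; there
   the two longest sides act as a single one, and induction applies. Their
   orientation is switched where they become antiparallel. *)
Lemma poly_conn n : forall I i0 a, length I = n -> NoDup (i0 :: I) ->
  (forall i, In i (i0 :: I) -> 0 <= a i) ->
  (forall j j', In j I -> In j' I -> j <> j' ->
     2 * (a j + a j') <= Rsum (i0 :: I) a) ->
  forall p q, poly (i0 :: I) a p -> poly (i0 :: I) a q ->
  conn (fun v => In v (i0 :: I)) (poly (i0 :: I) a) p q.
Proof.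
  induction n as [|n IH]; intros I0 i0 a Hl ND Ha Hshort p q Hp Hq.
  { destruct I0; [|easy]. apply conn_eq; auto. intros v [<-|[]].
    destruct Hp as [_ Hp], Hq as [_ Hq]. simpl in *. rewrite Cplus_0_r in Hp, Hq.
    congruence. }
  destruct (select_two (i0 :: I0) a) as [i1 [i2 [I [P [H12 M2]]]]]; [simpl; lia|].
  assert (Hin : forall j, In j (i1 :: i2 :: I) -> In j (i0 :: I0)).
  { intros j. apply Permutation_in. now symmetry. }
  assert (Ha' : forall i, In i (i1 :: i2 :: I) -> 0 <= a i) by auto.
  assert (ND' : NoDup (i1 :: i2 :: I)) by (eapply Permutation_NoDup; eauto).
  destruct (NoDup_cons2 _ _ _ ND') as [N1 [N2 [N3 N4]]].
  assert (HT := Rsum_perm _ _ a P). rewrite HT in Hshort. simpl Rsum in Hshort.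
  assert (Hpair : forall j, In j I -> 2 * a j - Rsum I a <= a i1 - a i2).
  (* The inequality says that [i2] and [j] are together at most half of the perimeter. At most one
     of [i1], [i2], [j] is [i0], and the pair formed by the other two is at least as long as this
     pair. *)
  { intros j Hj. assert (a j <= a i2) by auto.
    assert (J1 : In i1 (i0 :: I0)) by auto with datatypes.
    assert (J2 : In i2 (i0 :: I0)) by auto with datatypes.
    assert (J3 : In j (i0 :: I0)) by auto with datatypes.
    destruct J3 as [->|J3].
    - destruct J1 as [->|J1]; [tauto|]. destruct J2 as [->|J2]; [tauto|].
      specialize (Hshort i1 i2 J1 J2 N1). lra.
    - destruct J2 as [->|J2].
      + destruct J1 as [->|J1]; [tauto|].
        specialize (Hshort i1 j J1 J3 ltac:(intros ->; auto)). lra.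
      + specialize (Hshort i2 j J2 J3 ltac:(intros ->; auto)). lra. }
  apply (conn_mono (i1 :: i2 :: I) _ (poly (i1 :: i2 :: I) a)).
  { intros v. now apply Permutation_in. }
  { intros x. apply poly_perm. now symmetry. }
  apply (poly_perm _ _ _ _ P) in Hp. apply (poly_perm _ _ _ _ P) in Hq.
  assert (Hdiff : a i1 - a i2 <= Rsum I a).
  { destruct Hp as [A1 A2]. simpl in A2.
    assert (B : Cmod (Csum I p) <= Rsum I a)
      by (apply Csum_le; intros j Hj; apply A1; auto with datatypes).
    assert (B1 := Cmod_triangle_rev (p i1) (p i2)).
    rewrite !A1 in B1 by auto with datatypes.
    replace (p i1 + p i2)%C with (- Csum I p)%C in B1.
    2: { transitivity (p i1 + (p i2 + Csum I p) - Csum I p)%C; [|ring].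
         rewrite A2. ring. }
    rewrite Cmod_opp, Rabs_pos_eq in B1; lra. }
  assert (a2 : 0 <= a i2) by auto with datatypes.
  assert (SN : 0 <= Rsum I a) by (apply Rsum_nonneg; auto with datatypes).
  (* Without a positive base there is no rigid arm to merge into; in this case all sides in [I] have
     length 0. *)
  destruct (Req_dec (Rmin (a i1 + a i2) (Rsum I a)) 0) as [Z|Z].
  { apply poly_conn_flat; auto. intros j Hj.
    assert (0 <= a j) by auto with datatypes.
    assert (a j <= Rsum I a) by (apply Rsum_ge; auto with datatypes).
    specialize (M2 j Hj). unfold Rmin in Z. destruct Rle_dec; lra. }
  destruct (join_top i1 i2 I a p) as [s [c [Hs [C1 [C2 C3]]]]]; auto.
  destruct (join_top i1 i2 I a q) as [s' [c' [Hs' [C1' [C2' C3']]]]]; auto.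
  destruct (join_flip i1 i2 I a) as [d [d' [D1 [D1' [D2 [D2' D3]]]]]]; auto.
  set (t := Rmin (a i1 + a i2) (Rsum I a)) in *.
  assert (T : t <= a i1 + a i2 /\ t <= Rsum I a) by (split; [apply Rmin_l|apply Rmin_r]).
  assert (T1 : a i1 - a i2 <= t) by (apply Rmin_glb; lra).
  assert (B : forall s c c', s = 1 \/ s = -1 -> arms I a c -> Csum I c = RtoC t ->
    arms I a c' -> Csum I c' = RtoC t ->
    conn (fun v => In v (i1 :: i2 :: I)) (poly (i1 :: i2 :: I) a)
    (join i1 i2 I a s c) (join i1 i2 I a s c')).
  { intros. apply (join_base i1 i2 I a s0 t); auto; [lra..|].
    (* The merged arm becomes the side that may be long. Two other sides satisfy [a j + a j' <= t]
       and [a j + a j' <= Rsum I a], hence are together at most half of the new perimeter. *)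
    apply IH.
    - apply Permutation_length in P. simpl in P. lia.
    - now constructor.
    - intros j [<-|Hj]; [rewrite upd_eq; lra|].
      rewrite (upd_in a i1 t I) by auto. auto with datatypes.
    - intros j j' Hj Hj' Hjj. simpl. rewrite upd_eq, Rsum_upd by auto.
      rewrite !(upd_in a i1 t I) by auto.
      assert (a j + a j' <= a i1 + a i2).
      { assert (a j <= a i2) by auto. assert (a j' <= a i2) by auto. lra. }
      assert (a j + a j' <= Rsum I a).
      { destruct (in_split j I Hj) as [L [L' ->]].
        assert (PP : Permutation (L ++ j :: L') (j :: L ++ L'))
          by (symmetry; apply Permutation_middle).
        rewrite (Rsum_perm _ _ a PP). simpl.
        apply (Permutation_in _ PP) in Hj'. destruct Hj' as [|Hj']; [congruence|].
        apply Rplus_le_compat_l, Rsum_ge; auto. intros k Hk. apply Ha'.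
        right; right. eapply Permutation_in; [symmetry; exact PP|now right]. }
      assert (a j + a j' <= t) by now apply Rmin_glb. lra. }
  eapply conn_trans; [exact C3|].
  eapply conn_trans; [|apply conn_sym; exact C3'].
  destruct Hs as [->| ->], Hs' as [->| ->]; auto.
  - eapply conn_trans; [|apply (B (-1) d' c'); auto].
    eapply conn_trans; [apply (B 1 c d); auto|exact D3].
  - eapply conn_trans; [|apply (B 1 d c'); auto].
    eapply conn_trans; [apply (B (-1) c d'); auto|apply conn_sym; exact D3].
Qed.

(** * Linkages *)

Lemma poly_conn_perm I J i0 a : Permutation (i0 :: I) J -> NoDup (i0 :: I) ->
  (forall i, In i (i0 :: I) -> 0 <= a i) ->
  (forall j j', In j I -> In j' I -> j <> j' ->
     2 * (a j + a j') <= Rsum (i0 :: I) a) ->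
  forall p q, poly J a p -> poly J a q -> conn (fun v => In v J) (poly J a) p q.
Proof.
  intros P ND Ha Hs p q Hp Hq.
  apply (conn_mono (i0 :: I) _ (poly (i0 :: I) a)).
  - intros v. apply Permutation_in. now symmetry.
  - intros x. now apply poly_perm.
  - apply Permutation_sym in P.
    apply (poly_conn (length I)); auto; eapply poly_perm; eauto.
Qed.

Definition det (z w : C) : R := fst z * snd w - snd z * fst w.

(** By Lagrange's identity the inner product of [z] and [w] is plus or minus the product of the
    moduli when the determinant vanishes. *)
Lemma det_zero_Cmod z w : Cmod w <= Cmod z -> det z w = 0 ->
  Cmod (z + w) = Cmod z + Cmod w \/ Cmod (z + w) = Cmod z - Cmod w.
Proof.
  intros H D. assert (Hz := Cmod_sqr z). assert (Hw := Cmod_sqr w).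
  assert (z0 := Cmod_ge_0 z). assert (w0 := Cmod_ge_0 w).
  set (m := Cmod z) in *. set (m' := Cmod w) in *.
  unfold det in D. set (d := fst z * fst w + snd z * snd w).
  assert (Hd : d ^ 2 = (m * m') ^ 2).
  { rewrite Rpow_mult_distr, Hz, Hw.
    transitivity (d ^ 2 + (fst z * snd w - snd z * fst w) ^ 2).
    - rewrite D. ring.
    - unfold d. ring. }
  assert (Hd' : (d - m * m') * (d + m * m') = 0) by nra.
  destruct (Rmult_integral _ _ Hd') as [E|E]; [left|right]; apply Cmod_eq; try lra;
    simpl fst; simpl snd; unfold d in E; nra.
Qed.

(* If three sides were pairwise longer than half of the perimeter, [j1] and [j2]
   would be among them and could not be parallel. *)
Lemma poly_conn_parallel k j1 j2 I a e : NoDup (k :: j1 :: j2 :: I) ->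
  a j2 <= a j1 -> (forall j, In j I -> a j <= a j2) ->
  poly (k :: j1 :: j2 :: I) a e -> det (e j1) (e j2) = 0 ->
  forall J, Permutation (k :: j1 :: j2 :: I) J ->
  forall p q, poly J a p -> poly J a q -> conn (fun v => In v J) (poly J a) p q.
Proof.
  intros ND H12 HI [E1 E2] HD J HJ.
  assert (Ha : forall i, In i (k :: j1 :: j2 :: I) -> 0 <= a i).
  { intros i Hi. rewrite <- E1 by auto. apply Cmod_ge_0. }
  assert (HR : (e j1 + e j2)%C = (- Csum (k :: I) e)%C).
  { simpl in *. transitivity ((e k + (e j1 + (e j2 + Csum I e))) -
      (e k + Csum I e))%C; [ring|]. rewrite E2. ring. }
  destruct (det_zero_Cmod (e j1) (e j2)) as [N|N]; auto.
  { rewrite !E1; auto with datatypes. }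
  (* Same direction: [a j1 + a j2] is the modulus of the sum of the other sides, so it is at most
     half of the perimeter, and only [k] may be long. *)
  - apply (poly_conn_perm (j1 :: j2 :: I) J k); auto.
    intros j j' Hj Hj' Hjj.
    assert (B : Cmod (Csum (k :: I) e) <= Rsum (k :: I) a).
    { apply Csum_le. intros i [<-|Hi]; apply E1; auto with datatypes. }
    rewrite HR, Cmod_opp, !E1 in N by auto with datatypes. simpl in *.
    assert (a j + a j' <= a j1 + a j2); [|lra].
    destruct Hj as [<-|[<-|Hj]], Hj' as [<-|[<-|Hj']]; try congruence; try lra;
      repeat match goal with H : In _ I |- _ => apply HI in H end; lra.
  - assert (P : Permutation (k :: j1 :: j2 :: I) (j1 :: k :: j2 :: I)) by apply perm_swap.
    rewrite !E1 in N by auto with datatypes.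
    (* Opposite directions: together the two sides act as one of length [a j1 - a j2], and the
       polygon inequality for [j] against it gives the bound. Now [j1] is the side that may be
       long. *)
    assert (B : forall j, In j (k :: I) -> 2 * (a j2 + a j) <= a j1 + (a j2 + Rsum (k :: I) a)).
    { intros j Hj. assert (Hj' := Hj). apply in_split in Hj' as [L [L' HL]].
      assert (PP : Permutation (k :: I) (j :: L ++ L'))
        by (rewrite HL; symmetry; apply Permutation_middle).
      rewrite (Csum_perm _ _ _ PP) in HR. rewrite (Rsum_perm _ _ _ PP).
      simpl in HR |- *.
      assert (B1 : Cmod (Csum (L ++ L') e) <= Rsum (L ++ L') a).
      { apply Csum_le. intros i Hi.
        assert (In i (k :: I)) as [<-|Hi'].
        { eapply Permutation_in; [symmetry; exact PP|now right]. }
        - apply E1; auto with datatypes.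
        - apply E1; auto with datatypes. }
      assert (B2 : a j <= Cmod (e j1 + e j2) + Cmod (Csum (L ++ L') e)).
      { rewrite <- (E1 j) by (destruct Hj as [<-|]; auto with datatypes).
        rewrite <- (Cmod_opp (e j)).
        replace (- e j)%C with ((e j1 + e j2) + Csum (L ++ L') e)%C
          by (rewrite HR; ring).
        apply Cmod_triangle. }
      lra. }
    apply (poly_conn_perm (k :: j2 :: I) J j1).
    + now rewrite <- P.
    + eapply Permutation_NoDup; eauto.
    + intros i Hi. apply Ha. eapply Permutation_in; [symmetry; exact P|auto].
    + intros j j' Hj Hj' Hjj. simpl in *.
      assert (BK := B k (or_introl eq_refl)).
      destruct Hj as [<-|[<-|Hj]], Hj' as [<-|[<-|Hj']]; try congruence;
        repeat match goal with H : In _ I |- _ =>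
          pose proof (HI _ H); pose proof (B _ (or_intror H)); clear H end; lra.
Qed.

(** * Configurations of a path as closed polygons *)

Lemma Csum_seq_S m e : Csum (seq 0 (S m)) e = (Csum (seq 0 m) e + e m)%C.
Proof.
  rewrite (Csum_perm _ (m :: seq 0 m)); [simpl; ring|].
  rewrite seq_S. symmetry. apply Permutation_cons_append.
Qed.

(** Clamping makes the numbering of the vertices total, so that no proof of [j <= k] has to be
    carried along. *)
Definition vtx (k j : nat) : V (path_graph k) :=
  exist (fun j => (j <= k)%nat) (Nat.min j k) (Nat.le_min_r j k).

Lemma vtx_proj k j : (j <= k)%nat -> proj1_sig (vtx k j) = j.
Proof. apply Nat.min_l. Qed.

Lemma vtx_val k (v : V (path_graph k)) : vtx k (proj1_sig v) = v.
Proof.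
  apply eq_sig_hprop; [intros; apply le_unique|]. simpl.
  destruct v as [j Hj]; simpl. lia.
Qed.

(** Index [k] is the closing side, directed from the target back to the source. *)
Definition sides (k : nat) (q : V (path_graph k) -> C) (j : nat) : C :=
  if lt_dec j k then (q (vtx k (S j)) - q (vtx k j))%C
  else (q (vtx k 0) - q (vtx k k))%C.

Definition unfold_sides (k : nat) (e : nat -> C) (v : V (path_graph k)) : C :=
  Csum (seq 0 (proj1_sig v)) e.

Lemma Csum_sides k q j : (j <= k)%nat ->
  Csum (seq 0 j) (sides k q) = (q (vtx k j) - q (vtx k 0))%C.
Proof.
  induction j as [|j IH]; intros Hj.
  - simpl. ring.
  - rewrite Csum_seq_S, IH by lia. unfold sides. destruct lt_dec; [ring|lia].
Qed.

(** The fibre occurring in [nabla], with lengths read from a function on [nat]; [path_lengths]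
    matches it by conversion. *)
Definition fibre (k : nat) (b : nat -> R) (x : R) (q : config (path_graph k)) : Prop :=
  Cfg (path_graph k) (fun e => b (proj1_sig e)) q /\
  Defs.dist (q (path_src k)) (q (path_tgt k)) = x.

(** [point] and [C] are both [R * R] and the two formulas are convertible, so a configuration can be
    used directly as a complex-valued map. *)
Lemma dist_Cmod a b : Defs.dist a b = Cmod (a - b).
Proof. reflexivity. Qed.

Lemma sides_poly k b x q : fibre k b x q ->
  poly (seq 0 (S k)) (upd b k x) (sides k q).
Proof.
  intros [H1 H2]. split.
  - intros j Hj. apply in_seq in Hj. unfold sides. destruct lt_dec as [L|L].
    + rewrite upd_neq by lia. specialize (H1 (exist _ j L)). simpl in H1.
      rewrite <- H1, dist_Cmod, Cmod_minus_sym. do 3 f_equal.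
      * rewrite <- vtx_val. reflexivity.
      * f_equal. rewrite <- vtx_val. reflexivity.
    + replace j with k by lia. rewrite upd_eq, <- H2, dist_Cmod.
      rewrite <- (vtx_val k (path_src k)), <- (vtx_val k (path_tgt k)). reflexivity.
  - change (Csum (seq 0 (S k)) (sides k q) = RtoC 0).
    rewrite Csum_seq_S, Csum_sides by lia. unfold sides. destruct lt_dec; [lia|ring].
Qed.

Lemma unfold_fibre k b x e : poly (seq 0 (S k)) (upd b k x) e ->
  fibre k b x (unfold_sides k e).
Proof.
  intros [H1 H2]. split.
  - intros [j L].
    change (Cmod (Csum (seq 0 j) e - Csum (seq 0 (S j)) e) = b j).
    rewrite Csum_seq_S, Cmod_minus_sym.
    rewrite <- (upd_neq b k x) by lia.
    rewrite <- H1 by (apply in_seq; lia). f_equal. ring.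
  - change (Cmod (0 - Csum (seq 0 k) e) = x).
    rewrite Csum_seq_S in H2. assert (H3 := H1 k ltac:(apply in_seq; lia)).
    rewrite upd_eq in H3. rewrite <- H3. f_equal.
    transitivity (e k - (Csum (seq 0 k) e + e k))%C; [ring|]. rewrite H2. ring.
Qed.

Lemma rel_open_ext G X U p q : rel_open G X U -> X p -> U p -> X q ->
  (forall v, p v = q v) -> U q.
Proof.
  intros O Xp Up Xq H. destruct (O p Xp Up) as [e [He K]]. apply K; auto.
  intros v. rewrite H, dist_Cmod. unfold Cminus. rewrite Cplus_opp_r, Cmod_0. lra.
Qed.

Lemma rel_open_loc_const G X S D U1 U2 : (forall v, In v D) ->
  (forall p, S p -> X p) -> rel_open G X U1 -> rel_open G X U2 ->
  (forall p, S p -> U1 p \/ U2 p) -> (forall p, S p -> U1 p -> U2 p -> False) ->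
  loc_const (fun v => In v D) S U1.
Proof.
  intros HD HS O1 O2 Cov Dis p Sp. destruct (Cov p Sp) as [U|U].
  - destruct (O1 p (HS p Sp) U) as [e [He K]]. exists e. split; auto.
    intros q Hq Sq. split; auto. intros _. apply K; auto.
    intros v. apply Hq, HD.
  - destruct (O2 p (HS p Sp) U) as [e [He K]]. exists e. split; auto.
    intros q Hq Sq. split; intros U'; exfalso; [now apply (Dis p)|].
    apply (Dis q); auto. apply K; auto. intros v. apply Hq, HD.
Qed.

(** A separation of the quotient would pull back to the polygon space. Side vectors forget only the
    position of the first vertex, so passing between the two costs a translation. *)
Lemma fibre_connected k b x :
  (forall p q, poly (seq 0 (S k)) (upd b k x) p -> poly (seq 0 (S k)) (upd b k x) q ->
     conn (fun v => In v (seq 0 (S k))) (poly (seq 0 (S k)) (upd b k x)) p q) ->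
  quot_connected (path_graph k) (Cfg (path_graph k) (fun e => b (proj1_sig e)))
    (fibre k b x).
Proof.
  intros HC [U1 [U2 [O1 [O2 [S1 [S2 [Cov [Dis [[p1 [F1 V1]] [p2 [F2 V2]]]]]]]]]]].
  pose (D := map (vtx k) (seq 0 (S k))).
  assert (HD : forall v, In v D).
  { intros v. rewrite <- (vtx_val k v). apply in_map, in_seq. destruct v; simpl; lia. }
  assert (HS : forall p, fibre k b x p ->
    Cfg (path_graph k) (fun e => b (proj1_sig e)) p) by (intros p Hp; apply Hp).
  assert (CC : conn (fun v => In v D) (fibre k b x)
      (unfold_sides k (sides k p1)) (unfold_sides k (sides k p2))).
  { eapply (conn_map (seq 0 (S k))); [apply unfold_fibre| |
      apply HC; apply sides_poly; auto].
    intros e v _ _. apply (Csum_ctends _ _ (fun x => x)).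
    intros i Hi. apply coord_within. apply in_seq in Hi. apply in_seq.
    destruct v; simpl in Hi; lia. }
  assert (TR : forall U p, rel_open (path_graph k)
      (Cfg (path_graph k) (fun e => b (proj1_sig e))) U ->
    saturated (path_graph k) (Cfg (path_graph k) (fun e => b (proj1_sig e))) U ->
    fibre k b x p -> U p -> U (unfold_sides k (sides k p))).
  { intros U p O HU Fp Up.
    assert (Fp' := unfold_fibre _ _ _ _ (sides_poly _ _ _ _ Fp)).
    (* Rebuilding [p] from its sides gives its translate with first vertex at the origin, which a
       saturated set contains along with [p]. *)
    assert (EQ : forall v, act (path_graph k) 1 0 (- p (vtx k 0))%C p v =
      unfold_sides k (sides k p) v).
    { intros v. unfold unfold_sides. rewrite Csum_sides, vtx_val by (destruct v; auto).
      unfold act, motion. apply injective_projections; simpl; ring. }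
    refine (rel_open_ext _ _ _ _ _ O _ _ (HS _ Fp') EQ).
    - intros e. rewrite !EQ. apply Fp'.
    - apply HU; auto. ring. }
  apply (Dis (unfold_sides k (sides k p2))).
  - now apply unfold_fibre, sides_poly.
  - apply CC; [eapply rel_open_loc_const; eauto|]. now apply TR.
  - now apply TR.
Qed.

Lemma disconnected_of_det G l (v0 v1 v2 v3 : V G) :
  (exists p, Cfg G l p) ->
  (forall p : V G -> C, Cfg G l p -> det (p v1 - p v0) (p v3 - p v2) <> 0) ->
  ~ M_connected G l.
Proof.
  intros [p Hp] Hdet HM. apply HM.
  pose (f := fun p : V G -> C => det (p v1 - p v0) (p v3 - p v2)).
  assert (T : forall p, tends (cnear (fun _ => True) p) f p).
  { intros q.
    assert (TC := fun v => ctends_coord (fun _ => True) q v Logic.I).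
    unfold f, det. simpl.
    destruct (TC v0), (TC v1), (TC v2), (TC v3). tend. }
  assert (Hact : forall c s t q, c ^ 2 + s ^ 2 = 1 -> f (act G c s t q) = f q).
  { intros c s t q E. unfold f, det, act, motion. simpl.
    transitivity ((c ^ 2 + s ^ 2) * f q); [unfold f, det; simpl; ring|].
    rewrite E. unfold f, det; simpl; ring. }
  (* Complex conjugation is the reflection; it reverses the sign of the determinant. *)
  assert (Cp : Cfg G l (fun v => Cconj (p v))).
  { intros e. rewrite <- Hp, !dist_Cmod, <- Cmod_conj. f_equal.
    apply injective_projections; simpl; ring. }
  assert (Fp : f (fun v => Cconj (p v)) = - f p) by (unfold f, det; simpl; ring).
  assert (Op : forall g, (forall p, tends (cnear (fun _ => True) p) g p) ->
    rel_open G (Cfg G l) (fun q => 0 < g q)).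
  { intros g Tg p1 _ H1. destruct (tends_pos _ _ _ (Tg p1) H1) as [e [He K]].
    exists e. split; [exact He|]. intros q Xq Hq. apply K. intros v _. apply Hq. }
  exists (fun q => 0 < f q), (fun q => 0 < - f q).
  refine (conj _ (conj _ (conj _ (conj _ (conj _ (conj _ (conj _ _))))))).
  - now apply Op.
  - apply (Op (fun q => - f q)). intros p1. apply tends_opp; [typeclasses eauto|auto].
  - intros q c s t E Xq Uq. now rewrite Hact.
  - intros q c s t E Xq Uq. now rewrite Hact.
  - intros q Hq. specialize (Hdet q Hq). fold (f q) in Hdet. lra.
  - intros q Xq. lra.
  - specialize (Hdet p Hp). fold (f p) in Hdet.
    destruct (Rlt_dec 0 (f p)); [exists p; auto|].
    eexists; split; [exact Cp|]. lra.
  - specialize (Hdet p Hp). fold (f p) in Hdet.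
    destruct (Rlt_dec (f p) 0); [exists p; split; auto; lra|].
    eexists; split; [exact Cp|]. lra.
Qed.

Theorem mainTheorem12 (G : graph) (l : E G -> R) (u v : V G)
    (n : nat) (k : nat -> nat) (ws : nat -> nat -> V G) (es : nat -> nat -> E G)
    (K : E G -> Prop) :
  finite_graph G ->
  loopless G ->
  (forall e, 0 <= l e) ->
  (exists p, Cfg G l p) ->
  u <> v ->
  par_decomp G u v n k ws es K ->
  (forall i j, (i < n)%nat -> (j < k i)%nat -> 0 < l (es i j)) ->
  (exists i, (i < n)%nat /\
     forall x, nabla (k i) (path_lengths G l (k i) (es i)) x -> ~ dist_set G l u v x) ->
  ~ M_connected G l.
Proof.
  intros _ _ Hl Hex _ [_ [Hpath _]] _ [i [Hi Hnabla]].
  destruct (Hpath i Hi) as [Hk [W0 [Wk [_ [_ Hends]]]]].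
  set (m := k i) in *. set (w := ws i) in *. set (b := fun j => l (es i j)).
  pose (r := fun (p : V G -> C) (x : V (path_graph m)) => p (w (proj1_sig x))).
  assert (HF : forall p, Cfg G l p -> fibre m b (Defs.dist (p u) (p v)) (r p)).
  { intros p Hp. split.
    - intros [j L]. simpl. unfold b. rewrite <- Hp, !dist_Cmod. unfold r. simpl.
      destruct (Hends j L) as [-> | ->]; simpl; auto. apply Cmod_minus_sym.
    - unfold r. simpl. now rewrite W0, Wk. }
  assert (HN : forall p, Cfg G l p -> ~ quot_connected (path_graph m)
     (Cfg (path_graph m) (fun e => b (proj1_sig e))) (fibre m b (Defs.dist (p u) (p v)))).
  { intros p Hp HQ. apply (Hnabla (Defs.dist (p u) (p v))).
    - split; [|exact HQ]. exists (r p). apply (HF p Hp).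
    - exists p. auto. }
  (* A single edge offers no pair to compare. Its polygon is a digon, whose space is connected,
     which contradicts the hypothesis on nabla. *)
  assert (Hsplit : m = 1%nat \/ (2 <= m)%nat) by lia.
  destruct Hsplit as [M|M].
  { destruct Hex as [p Hp]. exfalso. apply (HN p Hp), fibre_connected.
    rewrite M. apply (poly_conn_perm (1 :: nil)%nat _ 0%nat); auto.
    - repeat constructor; simpl; lia.
    - intros j [<-|[<-|[]]]; [apply Hl|apply sqrt_pos].
    - intros j j' [<-|[]] [<-|[]]; lia. }
  destruct (select_two (seq 0 m) b) as [j1 [j2 [I [P [H12 HI]]]]].
  { now rewrite length_seq. }
  assert (Hj : forall j, In j (j1 :: j2 :: I) -> (j < m)%nat).
  { intros j Hj. apply (Permutation_in _ (Permutation_sym P)), in_seq in Hj. lia. }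
  assert (L1 : (j1 < m)%nat) by auto with datatypes.
  assert (L2 : (j2 < m)%nat) by auto with datatypes.
  apply (disconnected_of_det G l (w j1) (w (S j1)) (w j2) (w (S j2))); auto.
  intros p Hp Hdet. apply (HN p Hp), fibre_connected.
  (* The closing segment has index [m] and is kept apart from the edges: [j1] and [j2] are longest
     among the edges, whatever its length. *)
  assert (PS : Permutation (m :: j1 :: j2 :: I) (seq 0 (S m))).
  { rewrite <- P, seq_S. apply Permutation_cons_append. }
  assert (HU : forall j, In j (j1 :: j2 :: I) ->
    upd b m (Defs.dist (p u) (p v)) j = b j).
  { intros j H. apply upd_neq. specialize (Hj j H). lia. }
  apply (poly_conn_parallel m j1 j2 I _ (sides m (r p))); auto.
  - apply (Permutation_NoDup (Permutation_sym PS)), seq_NoDup.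
  - rewrite !HU; auto with datatypes.
  - intros j H. rewrite !HU; auto with datatypes.
  - apply (poly_perm _ _ _ _ (Permutation_sym PS)). now apply sides_poly, HF.
  - unfold sides. destruct (lt_dec j1 m), (lt_dec j2 m); try lia.
    unfold r. rewrite !vtx_proj by lia. exact Hdet.
Qed.
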